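(* Let $G$ be a countable discrete amenable group acting freely (by homeomorphisms) on a compact metrizable space $X$. Let $H \lhd G$ be an infinite normal subgroup such that the restricted action $H \curvearrowright X$ is almost finite. Then the action $G \curvearrowright X$ is almost finite.
   Context: All actions on compact metrizable spaces are by homeomorphisms. An action $\Gamma \curvearrowright X$ is free if $gx \neq x$ for all $x \in X$ and all $g \in \Gamma \setminus \{e\}$. Dynamical subequivalence. Let $\Gamma \curvearrowright X$ be an action of a countable discrete group on a compact metrizable space. For an open or closed set $U \subset X$ and an open set $V \subset X$, write $U \precsim_\Gamma V$ if for every compact subset $K \subset U$ there are finitely many open sets $U_1,\dots,U_n \subset X$ with $K \subset \bigcup_{i=1}^n U_i$ and elements $g_1,\dots,g_n \in \Gamma$ such that $g_1U_1,\dots,g_nU_n$ are pairwise disjoint subsets of $V$ ($n=0$ is allowed when $K=\emptyset$). Almost finiteness. Let $\Gamma \curvearrowright X$ be an action of a countable discrete amenable group on a compact metrizable space, and fix a (not necessarily invariant) compatible metric on $X$. The action is almost finite if for every finite subset $K \subset \Gamma$ and every $\varepsilon > 0$ there exists a finite collection $\{(S_i,V_i)\}_{i=1}^n$ such that: (1) for every $i$, the set $S_i \subset \Gamma$ is finite and $(K,\varepsilon)$-invariant, that is, $|S_i \,\Delta\, KS_i| < \varepsilon |S_i|$; (2) for every $i$, the set $V_i \subset X$ is open; (3) the open sets $sV_i$, for all $i=1,\dots,n$ and $s \in S_i$, are pairwise disjoint and have diameter smaller than $\varepsilon$; (4) there are subsets $S_i' \subset S_i$ with $|S_i'| < \varepsilon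 |S_i|$ such that $X \setminus \bigsqcup_{i=1}^n S_iV_i \precsim_\Gamma \bigsqcup_{i=1}^n S_i'V_i$, where $SV = \bigcup_{s\in S} sV$. *)

(* Defs.v *)
From mathcomp Require Import all_boot all_order all_algebra finmap.
From mathcomp Require Import all_classical all_reals topology ereal.

Set Implicit Arguments.
Unset Strict Implicit.
Unset Printing Implicit Defensive.

Import Order.TTheory GRing.Theory Num.Theory.

Local Open Scope classical_set_scope.
Local Open Scope ring_scope.

(** The groups are discrete, so they carry no topology. *)

Section Groups.
Variable G : groupType.

Definition set_mulg (K S : {fset G}) : {fset G} :=
  [fset (k * s)%g | k in K, s in S]%fset.

(** [(K, eps)]-invariance: [|S \Delta K S| < eps |S|]. The inequality is
    strict, so [S] is nonempty. *)
Definition fset_invariant (R : realType) (K : {fset G}) (eps : R)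
    (S : {fset G}) : Prop :=
  let KS := set_mulg K S in
  #|` ((S `\` KS) `|` (KS `\` S))%fset |%:R < eps * #|` S |%:R.

(** Amenability of a discrete group, in Folner's form. No [S] is
    [(set0, eps)]-invariant when [eps <= 1], hence [K != fset0]. *)
Definition amenable (R : realType) : Prop :=
  forall (K : {fset G}) (eps : R), K != fset0 -> 0 < eps ->
  exists S : {fset G}, fset_invariant K eps S.

Definition normal_subgroup (N : {pred G}) : Prop :=
  forall x g : G, x \in N -> (x ^ g)%g \in N.

End Groups.

Section Topology.
Variables X Y : topologicalType.

Definition homeomorphism (f : X -> Y) : Prop :=
  exists f' : Y -> X,
    [/\ cancel f f', cancel f' f, continuous f & continuous f'].

End Topology.

Section Actions.
Variables (G : groupType) (X : topologicalType) (act : G -> X -> X).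

Definition homeo_action : Prop :=
  [/\ forall x, act 1%g x = x,
      forall g h x, act (g * h)%g x = act g (act h x) &
      forall g, homeomorphism (act g)].

Definition free_action : Prop := forall g x, g != 1%g -> act g x <> x.

(** [S V], the union of the translates [s V] for [s] in [S]. *)
Definition translates (S : {fset G}) (V : set X) : set X :=
  \bigcup_(s in [set` S]) (act s @` V).

(** Meant for [U] open or closed and [V] open. *)
Definition dyn_subequiv (U V : set X) : Prop :=
  forall K : set X, compact K -> K `<=` U ->
  exists (n : nat) (W : 'I_n -> set X) (g : 'I_n -> G),
    [/\ forall i, open (W i),
        K `<=` \bigcup_i W i,
        trivIset [set: 'I_n] (fun i => act (g i) @` W i) &
        forall i, act (g i) @` W i `<=` V].

End Actions.

Definition diam (R : realType) (X : metricType R) (A : set X) : \bar R :=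
  maxe 0%E (ereal_sup [set (mdist p.1 p.2)%:E | p in A `*` A]).

(** The compatible metric is the one carried by [X]. As in [amenable], [K] has
    to be nonempty: for [K = fset0] and [eps <= 1] no shape [S i] is
    [(K, eps)]-invariant, which would leave no almost finite action on a
    nonempty space.
    Disjointness ranges over the pairs [(i, s)] with [s] in [S i]: the levels
    are disjoint both within one tower and across different towers. *)
Definition almost_finite (R : realType) (G : groupType) (X : metricType R)
    (act : G -> X -> X) : Prop :=
  forall (K : {fset G}) (eps : R), K != fset0 -> 0 < eps ->
  exists (n : nat) (S : 'I_n -> {fset G}) (V : 'I_n -> set X),
    [/\ forall i, fset_invariant K eps (S i),
        forall i, open (V i),
        trivIset [set p : 'I_n * G | p.2 \in S p.1]
          (fun p => act p.2 @` V p.1) /\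
        (forall i s, s \in S i -> (diam (act s @` V i) < eps%:E)%E) &
        exists S' : 'I_n -> {fset G},
          [/\ forall i, (S' i `<=` S i)%fset,
              forall i, #|` S' i |%:R < eps * #|` S i |%:R &
              dyn_subequiv act
                (~` \bigcup_i translates act (S i) (V i))
                (\bigcup_i translates act (S' i) (V i))]].

(* Main.v *)
Require Import Defs.
From mathcomp Require Import all_boot all_order all_algebra finmap.
From mathcomp Require Import all_classical all_reals topology ereal numfun.
From mathcomp Require Import zify ring lra.

Set Implicit Arguments.
Unset Strict Implicit.
Unset Printing Implicit Defensive.

Import Order.TTheory GRing.Theory Num.Theory.
Import metricType_numDomainType.

Local Open Scope classical_set_scope.
Local Open Scope ring_scope.

(** The proof replaces invariant measures by finite averages. For a subgroup
    [N] of [G], [mean_le act N f g] says that over every sufficiently invariant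
    finite subset of [N], and from every base point, the average of [f] is at
    most that of [g] up to an arbitrarily small error: morally, the integral
    of [f] is at most that of [g] for every [N]-invariant mean. This relation
    is a preorder, compatible with sums and nonnegative scalings, containing
    the pointwise order, and for which a bounded nonnegative function is
    equivalent to its translates by [N] ([mean_le_shift]). All densities below
    are estimated with these rules.

    Comparison for [N] ([labelled_comparison]). Let [A l] be closed and [B l]
    open, finitely many, with the sum of the indicators of the [A l] smaller in
    the [N]-mean than that of the [B l]. By compactness this survives a slight
    thickening. In a castle with very invariant shapes and levels of small
    diameter, every tower then has fewer pairs (level, [l]) where the level
    meets [A l] than pairs where it is contained in [B l], so that group
    elements can move the former injectively to the latter; the slots that are
    left over accommodate the remainder of the castle.

    Comparison for [G] ([comparison]). Suppose that [A] is smaller than [B] in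
    the [G]-mean. One finite set [T] of [G] witnesses this: every [T x] visits
    [A] less often than [B]. As [N] is infinite the towers of its castles are
    long, and their levels can be coloured by [T] so that each colour gets its
    fair share; this cuts [A] into sets [A t] and [B] into sets [B t], each
    having [1 / #|T|] of the [N]-mean of the whole. As [N] is normal this
    remains true after any translation, so that the family of all [t^-1 (A t)]
    is smaller in the [N]-mean than the family of all [t^-1 (B t)]. Moving the
    former into the latter within [N], and translating before and after by
    elements of [T], carries [A] into [B].

    Quasi-tilings ([tilable_all]). For any invariance [(K, e)], the group [G]
    has castles with shapes of that invariance and a complement of arbitrarily
    small mean. This is the Ornstein-Weiss greedy algorithm. By freeness, a
    given finite set [F] acts injectively on small open sets; sorting the
    levels of a castle of [N] yields disjoint small open sets covering all but
    a set of small mean, and these are searched one after the other for points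
    [x] whose orbit [F x] is still mostly uncovered. One pass multiplies the
    uncovered mean by at most [1 - a / 2] for a fixed [a > 0], and passes with
    smaller and smaller [F] drive it to [0].

    Conclusion. In a quasi-tiling for [G] whose complement is sparse enough, a
    small fraction of each shape has larger mean than the complement, and
    comparison for [G] moves the complement there. *)

(** * Finite subsets of a group *)

Section SumsOverSubsets.
Variable (R : realType).

Lemma ler_sum_subset (T : eqType) (A B : seq T) (f : T -> R) :
  uniq A -> uniq B -> {subset A <= B} -> (forall t, t \in B -> 0 <= f t) ->
  \sum_(t <- A) f t <= \sum_(t <- B) f t.
Proof.
move=> uA uB AB f0.
rewrite [leRHS](bigID (mem A)) /= -[in X in X + _]big_filter.
have -> : \sum_(t <- [seq t <- B | t \in A]) f t = \sum_(t <- A) f t.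
  apply: perm_big; apply: uniq_perm => // [|t]; first exact: filter_uniq.
  by rewrite mem_filter; case: (boolP (t \in A)) => //= /AB ->.
by rewrite lerDl big_seq_cond; apply: sumr_ge0 => t /andP[/f0].
Qed.

Lemma sumr_const_fset (T : choiceType) (A : {fset T}) (c : R) :
  \sum_(t <- A) c = c * #|` A|%:R.
Proof. by rewrite big_const_seq count_predT iter_addr_0 mulr_natr. Qed.

Lemma card_imfset_inj (T T' : choiceType) (f : T -> T') (A : {fset T}) :
  injective f -> #|` [fset f a | a in A]%fset| = #|` A|.
Proof. by move=> fI; rewrite card_imfset. Qed.

Lemma card_fset_filter (T : choiceType) (Q : {fset T}) (p : pred T) :
  #|` [fset x in Q | p x]%fset| = count p Q.
Proof.
rewrite -size_filter; apply: perm_size; apply: uniq_perm.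
- exact: fset_uniq.
- by rewrite filter_uniq // fset_uniq.
- by move=> x; rewrite mem_filter !inE andbC.
Qed.

Lemma card_fset_sum (T : choiceType) (F : {fset T}) (p : pred T) :
  #|` [fset x in F | p x]%fset|%:R = \sum_(x <- F) (p x)%:R :> R.
Proof.
rewrite card_fset_filter -sum1_count natr_sum big_mkcond.
by apply: eq_bigr => x _; case: ifP.
Qed.

End SumsOverSubsets.

Section Folner.
Variables (R : realType) (G : groupType).
Implicit Types (K S T : {fset G}) (d : R) (k : G).

Definition exit k S : {fset G} := [fset s in S | (k * s)%g \notin S]%fset.

(** An elementwise version of [fset_invariant]. Unlike the latter it is monotone
    in [K] and meaningful for [K = fset0], so that finitely many invariance
    requirements can be merged by taking unions. *)
Definition folner K d S : Prop :=
  S != fset0 /\ forall k, k \in K -> #|` exit k S|%:R <= d * #|` S|%:R.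

Lemma folner_weaken K K' d d' S :
  {subset K' <= K} -> d <= d' -> folner K d S -> folner K' d' S.
Proof.
move=> sK dd [S0 FS]; split=> // k /sK /FS h; apply: le_trans h _.
by apply: ler_wpM2r.
Qed.

Lemma card_gt0_folner K d S : folner K d S -> 0 < #|` S|%:R :> R.
Proof. by case=> S0 _; rewrite ltr0n cardfs_gt0. Qed.

Lemma sum_translate_le (f : G -> R) (M : R) k S :
  (forall g, 0 <= f g <= M) ->
  \sum_(s <- S) f (k * s)%g <= \sum_(s <- S) f s + M * #|` exit k S|%:R.
Proof.
move=> fM; rewrite (bigID (fun s => (k * s)%g \in S)) /=; apply: lerD.
  rewrite -big_filter -(big_map (fun s => (k * s)%g) xpredT f).
  apply: ler_sum_subset => //.
  - rewrite map_inj_uniq; last exact: mulgI.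
    by rewrite filter_uniq // fset_uniq.
  - exact: fset_uniq.
  - by move=> t /mapP[s]; rewrite mem_filter => /andP[h _] ->.
  - by move=> t _; case/andP: (fM t).
rewrite -sumr_const_fset -big_filter.
apply: (@le_trans _ _ (\sum_(s <- [seq s <- S | (k * s)%g \notin S]) M)).
  by apply: ler_sum => s _; case/andP: (fM (k * s)%g).
apply: ler_sum_subset => //.
- by rewrite filter_uniq // fset_uniq.
- exact: fset_uniq.
- by move=> s; rewrite mem_filter !inE andbC.
- by move=> _ _; case/andP: (fM 1%g); apply: le_trans.
Qed.

Lemma card_exit k S : #|` exit k S| =
  #|` ([fset (k * s)%g | s in S] `\` S)%fset|.
Proof.
rewrite -(card_imfset_inj (exit k S) (@mulgI _ k)).
congr (size (enum_fset _)); apply/fsetP => t; rewrite !inE.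
apply/imfsetP/andP => [[s /=] | [tS /imfsetP[s /= sS ts]]].
  by rewrite !inE => /andP[sS ksS] ->; split=> //; apply/imfsetP; exists s.
by exists s => //=; rewrite !inE sS -ts.
Qed.

Lemma in_set_mulg K S k s : k \in K -> s \in S -> (k * s)%g \in set_mulg K S.
Proof. by move=> kK sS; apply/imfset2P; exists k => //=; exists s. Qed.

Lemma set_mulgP K S t :
  t \in set_mulg K S -> exists k s, [/\ k \in K, s \in S & t = (k * s)%g].
Proof. by case/imfset2P=> k /= kK [s /= sS ->]; exists k, s. Qed.

Lemma fset_invariant_folner K d S : fset_invariant K d S -> folner K d S.
Proof.
rewrite /fset_invariant => inv.
split=> [|k kK].
  by apply: contraTneq inv => ->; rewrite cardfs0 mulr0 -leNgt ler0n.
apply: le_trans (ltW inv); rewrite ler_nat card_exit.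
apply: fsubset_leq_card; apply/fsubsetP => t; rewrite !inE.
case/andP=> tS /imfsetP[s /= sS ts].
by rewrite (negPf tS) /= ts in_set_mulg.
Qed.

(** A nonempty [K] gives [#|S| <= #|K S|], so that [S \ K S] is no larger than
    [K S \ S], which is a union of translates of the sets [exit k S]. *)
Lemma folner_fset_invariant K d e S : K != fset0 ->
  2 * #|` K|%:R * d < e -> folner K d S -> fset_invariant K e S.
Proof.
move=> /fset0Pn[k0 k0K] de FS; have S0 := card_gt0_folner FS.
rewrite /fset_invariant; set KS := set_mulg K S.
have out : #|` (KS `\` S)%fset|%:R <= #|` K|%:R * d * #|` S|%:R :> R.
  have le1 : (#|` (KS `\` S)%fset| <= \sum_(k <- K) #|` exit k S|)%N.
    have sub : {subset (KS `\` S)%fset <=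
        flatten [seq [seq (k * s)%g | s <- exit k S] | k <- K]}.
      move=> t; rewrite !inE => /andP[tS /set_mulgP[k [s [kK sS ts]]]].
      apply/flattenP; exists [seq (k * s)%g | s <- exit k S].
        by apply/mapP; exists k.
      by apply/mapP; exists s => //; rewrite !inE sS -ts.
    apply: leq_trans (uniq_leq_size (fset_uniq _) sub) _.
    rewrite size_flatten /shape -map_comp sumnE big_map.
    by apply: leq_sum => k _ /=; rewrite size_map.
  apply: (@le_trans _ _ (\sum_(k <- K) #|` exit k S|%:R)).
    by rewrite -natr_sum ler_nat.
  apply: (@le_trans _ _ (\sum_(k <- K) d * #|` S|%:R)).
    by rewrite big_seq [leRHS]big_seq; apply: ler_sum => k kK; apply: FS.2.
  by rewrite sumr_const_fset mulrC mulrA.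
have inn : (#|` (S `\` KS)%fset| <= #|` (KS `\` S)%fset|)%N.
  have cS : (#|` S| <= #|` KS|)%N.
    rewrite -(card_imfset_inj S (@mulgI _ k0)).
    apply: fsubset_leq_card; apply/fsubsetP => t /imfsetP[s /= sS ->].
    exact: in_set_mulg.
  by rewrite !cardfsD fsetIC leq_sub2r.
apply: (@le_lt_trans _ _ (2 * #|` K|%:R * d * #|` S|%:R)); last first.
  by rewrite ltr_pM2r.
have := cardfsUI (S `\` KS)%fset (KS `\` S)%fset => hU.
have : (#|` ((S `\` KS) `|` (KS `\` S))%fset| <= 2 * #|` (KS `\` S)%fset|)%N.
  by lia.
rewrite -(ler_nat R) natrM => h; apply: le_trans h _.
by rewrite -!mulrA ler_wpM2l // mulrA.
Qed.

(** If [S] is invariant enough, some [s] in [S] is moved out of [S] by no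
    element of [K], whence a translate [K s] inside [S]. *)
Lemma folner_card K d S :
  folner K d S -> d * #|` K|%:R < 1 -> (#|` K| <= #|` S|)%N.
Proof.
move=> FS dK; have S0 := card_gt0_folner FS.
have [s sS Ks] : exists2 s, s \in S & forall k, k \in K -> (k * s)%g \in S.
  apply/not_exists2P => nK.
  have : #|` S|%:R <= \sum_(k <- K) #|` exit k S|%:R :> R.
    rewrite -natr_sum ler_nat.
    have sub : {subset S <= flatten [seq enum_fset (exit k S) | k <- K]}.
      move=> s sS; case: (nK s) => // /existsNP[k /not_implyP[kK ksS]].
      apply/flattenP; exists (enum_fset (exit k S)); first by apply/mapP;
        exists k.
      by rewrite !inE sS; apply/negP.
    apply: leq_trans (uniq_leq_size (fset_uniq _) sub) _.
    by rewrite size_flatten /shape -map_comp sumnE big_map.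
  apply/negP; rewrite -ltNge.
  apply: (@le_lt_trans _ _ (\sum_(k <- K) d * #|` S|%:R)).
    by rewrite big_seq [leRHS]big_seq; apply: ler_sum => k kK; apply: FS.2.
  by rewrite sumr_const_fset mulrAC gtr_pMl.
rewrite -(card_imfset_inj K (@mulIg _ s)).
by apply: fsubset_leq_card; apply/fsubsetP => t /imfsetP[k /= /Ks h ->].
Qed.

End Folner.

(** * Inequalities in the mean *)

Section InequalitiesInTheMean.
Variables (R : realType) (G : groupType) (X : Type) (act : G -> X -> X).
Hypothesis act1 : forall x, act 1%g x = x.
Hypothesis actM : forall g h x, act (g * h)%g x = act g (act h x).
Implicit Types (N : {pred G}) (f g h : X -> R) (c : R).

(** For an amenable subgroup [N] and bounded functions, this is the inequality
    between the integrals of [f] and [g] against every [N]-invariant finitely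
    additive probability. The invariance that a given error requires is uniform
    in the base point [x]. *)
Definition mean_le N f g : Prop := forall eta : R, 0 < eta ->
  exists (K : {fset G}) (d : R), [/\ {subset K <= N}, 0 < d &
    forall T : {fset G}, {subset T <= N} -> folner K d T ->
    forall x, \sum_(t <- T) f (act t x) <=
              \sum_(t <- T) g (act t x) + eta * #|` T|%:R].

Lemma mean_leW N f g : (forall x, f x <= g x) -> mean_le N f g.
Proof.
move=> fg eta eta0; exists fset0, 1; split=> // T _ _ x.
by rewrite -[leLHS]addr0 lerD ?mulr_ge0 ?ler_sum // ltW.
Qed.

Lemma mean_le_add N f f' g g' : mean_le N f g -> mean_le N f' g' ->
  mean_le N (fun x => f x + f' x) (fun x => g x + g' x).
Proof.
move=> D D' eta eta0; have eta2 : 0 < eta / 2 by rewrite divr_gt0.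
have [K [d [KN d0 H]]] := D _ eta2; have [K' [d' [KN' d0' H']]] := D' _ eta2.
exists (K `|` K')%fset, (Num.min d d'); split.
- by move=> k; rewrite inE => /orP[/KN|/KN'].
- by rewrite lt_min d0.
move=> T TN FT x; rewrite !big_split /=.
have -> a b e (n : R) :
    a + b + e * n = (a + e / 2 * n) + (b + e / 2 * n) by field.
apply: lerD; [apply: H => //|apply: H' => //]; apply: folner_weaken FT.
- by move=> k kK; rewrite inE kK.
- by rewrite ge_min lexx.
- by move=> k kK; rewrite inE kK orbT.
- by rewrite ge_min lexx orbT.
Qed.

Lemma mean_le_trans N g f h : mean_le N f g -> mean_le N g h -> mean_le N f h.
Proof.
move=> D D' eta /(mean_le_add D D')[K [d [KN d0 H]]].
exists K, d; split=> // T TN FT x; have := H T TN FT x.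
by rewrite !big_split /=; lra.
Qed.

Lemma mean_le_scale N c f g : 0 <= c -> mean_le N f g ->
  mean_le N (fun x => c * f x) (fun x => c * g x).
Proof.
move=> c0 D eta eta0.
have [K [d [KN d0 H]]] := D _ (divr_gt0 eta0 (ltr_wpDl c0 (@ltr01 R))).
exists K, d; split=> // T TN FT x; rewrite -!mulr_sumr.
apply: le_trans (ler_wpM2l c0 (H T TN FT x)) _.
rewrite mulrDr lerD2l mulrA ler_wpM2r // mulrCA ler_piMr ?(ltW eta0) //.
by rewrite ler_pdivrMr ?mul1r ?lerDl // ltr_wpDl.
Qed.

Lemma mean_le_sum N (I : Type) (r : seq I) (P : pred I) (f g : I -> X -> R) :
  (forall i, P i -> mean_le N (f i) (g i)) ->
  mean_le N (fun x => \sum_(i <- r | P i) f i x)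
        (fun x => \sum_(i <- r | P i) g i x).
Proof.
move=> D; elim: r => [|i r IH].
  by apply: mean_leW => x; rewrite !big_nil.
have [Pi|nPi] := boolP (P i); last first.
  apply: mean_le_trans (mean_le_trans IH _); apply: mean_leW => x;
  by rewrite big_cons (negPf nPi).
apply: mean_le_trans (mean_le_trans (mean_le_add (D i Pi) IH) _);
  apply: mean_leW => x;
by rewrite big_cons Pi.
Qed.

Lemma mean_le_shift N (k : G) (M : R) f : k \in N ->
  (forall x, 0 <= f x <= M) -> mean_le N (fun x => f (act k x)) f.
Proof.
move=> kN fM eta eta0; exists [fset k]%fset, (eta / (`|M| + 1)).
have M1 : 0 < `|M| + 1 by rewrite ltr_wpDl.
split=> [k'||T _ FT x]; rewrite ?divr_gt0 ?inE //; first by move/eqP=> ->.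
have := sum_translate_le k T (fun s : G => fM (act s x)).
under eq_bigr do rewrite actM.
move=> h; apply: le_trans h _; rewrite lerD2l.
have kT : #|` exit k T|%:R <= eta / (`|M| + 1) * #|` T|%:R.
  by apply: FT.2; rewrite inE.
apply: (@le_trans _ _ ((`|M| + 1) * #|` exit k T|%:R)).
  by rewrite ler_wpM2r // (le_trans (ler_norm M)) // lerDl.
by rewrite mulrC -ler_pdivlMr // mulrAC.
Qed.

Lemma mean_le_unshift N (k : G) (M : R) f : (k^-1)%g \in N ->
  (forall x, 0 <= f x <= M) -> mean_le N f (fun x => f (act k x)).
Proof.
move=> kN fM.
have := @mean_le_shift N (k^-1)%g M (fun x => f (act k x)) kN.
move=> /(_ (fun x => fM (act k x))) D; apply: mean_le_trans D.
by apply: mean_leW => x; rewrite -actM mulgV act1.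
Qed.

Lemma mean_le_average N (T : {fset G}) (M : R) f :
  (forall k, k \in T -> (k^-1)%g \in N) -> (forall x, 0 <= f x <= M) ->
  mean_le N (fun x => #|` T|%:R * f x) (fun x => \sum_(t <- T) f (act t x)).
Proof.
move=> TN fM; apply: (@mean_le_trans _ (fun x => \sum_(t <- T | t \in T) f x)).
  by apply: mean_leW => x; rewrite -big_seq sumr_const_fset mulrC.
apply: (mean_le_trans (g := fun x => \sum_(t <- T | t \in T) f (act t x))).
  by apply: mean_le_sum => t tT; apply: mean_le_unshift fM; apply: TN.
by apply: mean_leW => x; rewrite -big_seq.
Qed.

Definition has_folner N : Prop := forall K (d : R), {subset K <= N} -> 0 < d ->
  exists2 T : {fset G}, {subset T <= N} & folner K d T.

(** Uniformity in the base point turns a strict inequality in the mean into one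
    over a single finite set. *)
Lemma mean_le_finite_witness N f c c' : has_folner N -> c < c' ->
  mean_le N f (fun=> c) ->
  exists T : {fset G}, [/\ {subset T <= N}, T != fset0 &
    forall x, \sum_(t <- T) f (act t x) <= c' * #|` T|%:R].
Proof.
move=> FN cc D; have c0 : 0 < c' - c by rewrite subr_gt0.
have [K [d [KN d0 H]]] := D _ c0.
have [T TN FT] := FN K d KN d0; exists T; split=> //; first exact: FT.1.
move=> x; apply: le_trans (H T TN FT x) _.
by rewrite sumr_const_fset -mulrDl addrC subrK.
Qed.

End InequalitiesInTheMean.

(** * Indicator functions *)

Section Indicators.
Variables (R : realType) (X : Type).
Implicit Types (A B : set X).

Lemma ind_bound A x : 0 <= (indic A x : R) <= 1.
Proof. by rewrite indicE; case: (x \in A); rewrite ?lexx ?ler01. Qed.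

Lemma ind_ge0 A x : 0 <= indic A x :> R.
Proof. by case/andP: (ind_bound A x). Qed.

Lemma ind_le1 A x : indic A x <= 1 :> R.
Proof. by case/andP: (ind_bound A x). Qed.

Lemma ind_in A x : A x -> indic A x = 1 :> R.
Proof. by move=> Ax; rewrite indicE mem_set. Qed.

Lemma ind_out A x : ~ A x -> indic A x = 0 :> R.
Proof. by move=> Ax; rewrite indicE memNset. Qed.

Lemma ind_le A B x y : (A x -> B y) -> indic A x <= indic B y :> R.
Proof.
move=> AB; have [/AB By|nA] := pselect (A x); last first.
  by rewrite (ind_out nA) ind_ge0.
by rewrite (ind_in By) ind_le1.
Qed.

Lemma indC A x : indic (~` A) x = 1 - indic A x :> R.
Proof.
have [Ax|nAx] := pselect (A x).
  by rewrite (ind_in Ax) ind_out ?subrr // => /(_ Ax).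
by rewrite (ind_out nAx) ind_in // subr0.
Qed.

Lemma indU_le A B x : indic (A `|` B) x <= indic A x + indic B x :> R.
Proof.
have [Ax|nA] := pselect (A x).
  by rewrite (ind_in Ax) (le_trans (ind_le1 _ _)) // lerDl ind_ge0.
by rewrite (ind_out nA) add0r; apply: ind_le => -[].
Qed.

Lemma ind_le_sum (I : eqType) (r : seq I) (A : set X) (B : I -> set X) x
    (y : I -> X) :
  (A x -> exists2 i, i \in r & B i (y i)) ->
  indic A x <= \sum_(i <- r) indic (B i) (y i) :> R.
Proof.
move=> AB; have s0 (r' : seq I) : 0 <= \sum_(i <- r') indic (B i) (y i) :> R.
  by apply: sumr_ge0 => i _; apply: ind_ge0.
have [/AB[i ir Bi]|nA] := pselect (A x); last by rewrite (ind_out nA).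
by rewrite (big_rem i) //= (ind_in Bi) -[leLHS]addr0 lerD // ind_le1.
Qed.

Lemma sum_ind_le (I : eqType) (r : seq I) (A : set X) (B : I -> set X) x
    (y : I -> X) : uniq r ->
  (forall i, i \in r -> B i (y i) -> A x) ->
  (forall i j, i \in r -> j \in r -> B i (y i) -> B j (y j) -> i = j) ->
  \sum_(i <- r) indic (B i) (y i) <= indic A x :> R.
Proof.
move=> ur BA Bd.
have [[i [ir Bi]]|nB] := pselect (exists i, i \in r /\ B i (y i)).
  rewrite (ind_in (BA _ ir Bi)) (bigD1_seq i) //= big_seq_cond big1.
    by rewrite addr0 ind_le1.
  move=> j /andP[jr /eqP ji]; rewrite ind_out // => Bj.
  by apply: ji; apply: Bd.
rewrite big_seq big1; first exact: ind_ge0.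
by move=> i ir; rewrite ind_out // => Bi; apply: nB; exists i.
Qed.

End Indicators.
Arguments ind_bound {R X} A x.
Arguments ind_ge0 {R X} A x.
Arguments ind_le1 {R X} A x.
Arguments ind_in {R X A x}.
Arguments ind_out {R X A x}.

(** * Towers and castles *)

Section NormalSubgroups.
Variable (G : groupType).

Definition normal_subg (N : {pred G}) : Prop :=
  [/\ (1%g : G) \in N, forall x y : G, x \in N -> y \in N -> (x * y)%g \in N,
      forall x : G, x \in N -> (x^-1)%g \in N & normal_subgroup N].

End NormalSubgroups.

Section Towers.
Variables (R : realType) (G : groupType) (X : Type) (act : G -> X -> X).
Hypothesis act1 : forall x, act 1%g x = x.
Hypothesis actM : forall g h x, act (g * h)%g x = act g (act h x).

Lemma actK g x : act g^-1%g (act g x) = x.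
Proof. by rewrite -actM mulVg act1. Qed.

Lemma actVK g x : act g (act g^-1%g x) = x.
Proof. by rewrite -actM mulgV act1. Qed.

Lemma act_inj g : injective (act g).
Proof. exact: can_inj (actK g). Qed.

Lemma act_conj k g x : act k (act g x) = act g (act (k ^ g)%g x).
Proof. by rewrite -!actM conjgE !mulgA mulgV mul1g. Qed.

Section Castle.
Variables (I : finType) (S T : I -> {fset G}) (V : I -> set X).

(** The shapes are an argument because parts of a castle, over the same bases,
    are needed too. *)
Definition foot (U : I -> {fset G}) : set X :=
  [set y | exists i s, s \in U i /\ V i (act s^-1%g y)].

Definition disjoint_towers : Prop := forall i j s t x y,
  s \in S i -> t \in S j -> V i x -> V j y -> act s x = act t y ->
  i = j /\ s = t.

Hypothesis SV : disjoint_towers.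
Hypothesis TS : forall i, {subset T i <= S i}.

Lemma ind_foot y :
  indic (foot T) y = \sum_i \sum_(s <- T i) indic (V i) (act s^-1%g y) :> R.
Proof.
have lev i j s t : s \in T i -> t \in T j ->
    V i (act s^-1%g y) -> V j (act t^-1%g y) -> i = j /\ s = t.
  by move=> /TS sS /TS tS Vi Vj; apply: SV sS tS Vi Vj _; rewrite !actVK.
have [[i [s [sT Vs]]]|nf] := pselect (foot T y); last first.
  rewrite (ind_out nf) big1 // => i _; rewrite big_seq big1 // => s sT.
  by rewrite ind_out // => Vs; apply: nf; exists i, s.
rewrite ind_in; last by exists i, s.
rewrite (bigD1 i) //= (bigD1_seq s) //= ?fset_uniq // (ind_in Vs).
rewrite [X in _ + X + _]big_seq_cond big1 => [|t /andP[tT /eqP ts]]; last first.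
  by rewrite ind_out // => Vt; apply: ts; case: (lev _ _ _ _ tT sT Vt Vs).
rewrite big1 ?addr0 // => j /eqP ji; rewrite big_seq big1 // => t tT.
by rewrite ind_out // => Vt; apply: ji; case: (lev _ _ _ _ tT sT Vt Vs).
Qed.

Variable M : {pred G}.
Hypothesis normalM : normal_subg M.
Hypothesis TM : forall i, {subset T i <= M}.

(** Levels of one tower are translates of its base, so the mean of a castle is
    the number of its levels, weighted by the means of the bases. A further
    translation by any [g] in the ambient group is harmless because [M] is
    normal, even when [g] lies outside [M]. *)
Lemma mean_le_foot_levels (g : G) : @mean_le R _ _ act M
  (fun x => indic (foot T) (act g x))
  (fun x => \sum_i #|` T i|%:R * indic (V i) (act g x)).
Proof.
have [_ _ MV MJ] := normalM.
apply: (mean_le_trans (g := fun x => \sum_i \sum_(s <- T i | s \in T i)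
    indic (V i) (act g (act (s^-1 ^ g)%g x)))).
  apply: mean_leW => x; rewrite ind_foot; apply: ler_sum => i _.
  by rewrite big_seq; apply: ler_sum => s _; rewrite act_conj.
apply: (mean_le_trans (g := fun x => \sum_i \sum_(s <- T i | s \in T i)
    indic (V i) (act g x))).
  apply: mean_le_sum => i _; apply: mean_le_sum => s sT.
  apply: (mean_le_shift actM (M := 1) (f := fun x => indic (V i) (act g x))).
    by apply: MJ; apply: MV; apply: TM sT.
  by move=> x; apply: ind_bound.
apply: mean_leW => x; apply: ler_sum => i _.
by rewrite -big_seq sumr_const_fset mulrC.
Qed.

Lemma mean_le_levels_foot (g : G) : @mean_le R _ _ act M
  (fun x => \sum_i #|` T i|%:R * indic (V i) (act g x))
  (fun x => indic (foot T) (act g x)).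
Proof.
have [_ _ MV MJ] := normalM.
apply: (mean_le_trans (g := fun x => \sum_i \sum_(s <- T i | s \in T i)
    indic (V i) (act g x))).
  apply: mean_leW => x; apply: ler_sum => i _.
  by rewrite -big_seq sumr_const_fset mulrC.
apply: (mean_le_trans (g := fun x => \sum_i \sum_(s <- T i | s \in T i)
    indic (V i) (act g (act (s^-1 ^ g)%g x)))).
  apply: mean_le_sum => i _; apply: mean_le_sum => s sT.
  apply: (mean_le_unshift act1 actM (M := 1)
    (f := fun x => indic (V i) (act g x))).
    by rewrite -conjVg invgK; apply: MJ; apply: TM sT.
  by move=> x; apply: ind_bound.
apply: mean_leW => x; rewrite ind_foot; apply: ler_sum => i _.
by rewrite [leRHS]big_seq; apply: ler_sum => s _; rewrite [in leRHS]act_conj.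
Qed.

End Castle.
End Towers.

Section AlmostFinite.
Variables (R : realType) (G : groupType) (X : metricType R).
Variable (act : G -> X -> X).
Hypothesis act1 : forall x, act 1%g x = x.
Hypothesis actM : forall g h x, act (g * h)%g x = act g (act h x).
Implicit Types (N M : {pred G}) (K : {fset G}) (d : R).

(** Almost finiteness at scale [(K, d)], for the subgroup [N] and with the
    witnesses [W], [h] of the subequivalence of the remainder spelled out. All
    shapes live in [G], so that [N] and [G] are treated alike. *)
Record exhausting_castle N K d (I J : finType) (S S' : I -> {fset G})
    (V : I -> set X) (W : J -> set X) (h : J -> G) : Prop := {
  castle_in : forall i, {subset S i <= N};
  castle_folner : forall i, folner K d (S i);
  castle_open : forall i, open (V i);
  castle_disjoint : disjoint_towers act S V;
  castle_small : forall i s x y,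
    s \in S i -> V i x -> V i y -> mdist (act s x) (act s y) < d;
  part_sub : forall i, {subset S' i <= S i};
  part_small : forall i, #|` S' i|%:R <= d * #|` S i|%:R;
  rest_open : forall j, open (W j);
  rest_in : forall j, h j \in N;
  rest_cover : forall x, foot act V S x \/ exists j, W j x;
  rest_to_part : forall j x, W j x -> foot act V S' (act (h j) x);
  rest_disjoint : forall j j' x x',
    W j x -> W j' x' -> act (h j) x = act (h j') x' -> j = j' }.

Definition almost_finite_along N : Prop := forall K d,
  {subset K <= N} -> 0 < d ->
  exists (I J : finType) S S' V W h, @exhausting_castle N K d I J S S' V W h.

Definition rest (J : finType) (W : J -> set X) : set X :=
  [set x | exists j, W j x].

(** The remainder is moved disjointly into a part of the castle of density at
    most [d], so no invariant measure gives it more than [d]. *)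
Lemma mean_le_rest N M K d (I J : finType) S S' V W h (g : G) :
  @exhausting_castle N K d I J S S' V W h ->
  {subset N <= M} -> normal_subg M -> 0 < d ->
  mean_le act M (fun x => indic (rest W) (act g x)) (fun=> d).
Proof.
move=> C NM nM d0; have [_ _ _ MJ] := nM.
pose Q j := [set z | W j (act (h j)^-1%g z)].
apply: (mean_le_trans
    (g := fun x => \sum_j indic (Q j) (act g (act (h j ^ g)%g x)))).
  apply: mean_leW => x; apply: ind_le_sum => -[j Wj]; exists j.
    exact: mem_index_enum.
  by rewrite -act_conj // /Q /= actK.
apply: (mean_le_trans (g := fun x => \sum_j indic (Q j) (act g x))).
  apply: mean_le_sum => j _.
  apply: (mean_le_shift actM (M := 1) (f := fun x => indic (Q j) (act g x))).
    by apply: MJ; apply: NM; apply: rest_in C _.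
  by move=> x; apply: ind_bound.
apply: (mean_le_trans (g := fun x => indic (foot act V S') (act g x))).
  apply: mean_leW => x; apply: sum_ind_le; first exact: index_enum_uniq.
    by move=> j _ /(rest_to_part C); rewrite actVK.
  move=> j j' _ _ Wj Wj'; apply: (rest_disjoint C) Wj Wj' _.
  by rewrite !actVK.
have SM i : {subset S i <= M} by move=> s /(castle_in C) /NM.
have S'S := part_sub C; have SV := castle_disjoint C.
have S'M i : {subset S' i <= M} by move=> s /S'S /SM.
apply: mean_le_trans (mean_le_foot_levels act1 actM SV S'S nM S'M g) _.
apply: (mean_le_trans
    (g := fun x => d * \sum_i #|` S i|%:R * indic (V i) (act g x))).
  apply: mean_leW => x; rewrite mulr_sumr; apply: ler_sum => i _.
  by rewrite mulrA ler_wpM2r ?(part_small C).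
have Ssub i : {subset S i <= S i} by [].
apply: mean_le_trans (mean_le_scale (ltW d0)
  (mean_le_levels_foot act1 actM SV Ssub nM SM g)) _.
by apply: mean_leW => x; rewrite ler_piMr ?(ltW d0).
Qed.

End AlmostFinite.

(** * Thickenings of closed sets *)

Section Neighbourhoods.
Variables (R : realType) (X : metricType R).
Implicit Types (A D : set X) (d r : R).

Definition nbh A d : set X := [set y | exists2 a, A a & mdist a y < d].

Lemma open_nbh A d : open (nbh A d).
Proof.
rewrite openE => y [a Aa ay]; apply/nbhs_mdistP.
exists (d - mdist a y) => /=; first by rewrite subr_gt0.
move=> z /= yz; exists a => //.
by apply: le_lt_trans (metric_triangle _ y _) _; lra.
Qed.

Definition small_scales : set_system R :=
  filter_from (fun e : R => 0 < e) (fun e => [set e' | 0 < e' < e]).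

#[local] Instance small_scales_filter : Filter small_scales.
Proof.
apply: filter_from_filter; first by exists 1.
move=> e e' e0 e'0; exists (Num.min e e'); first by rewrite /= lt_min e0.
by move=> t /= /andP[t0]; rewrite lt_min => /andP[te te']; split; apply/andP.
Qed.

(** Each summand is upper semicontinuous jointly in the point and in the
    thickness, at thickness [0], because [A i] is closed; compactness makes the
    thickness uniform. *)
Lemma nbh_sum_lt (I : finType) (A : I -> set X) (f : I -> X -> X) D r :
  compact D -> (forall i, closed (A i)) -> (forall i, continuous (f i)) ->
  (forall x, D x -> \sum_i indic (A i) (f i x) < r) ->
  exists2 d, 0 < d &
    forall x, D x -> \sum_i indic (nbh (A i) d) (f i x) < r.
Proof.
move=> /compact_near_coveringP cD cA cf lt_r.
have [x Dx|e e0 He] := cD _ small_scales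
  (fun d x => \sum_i indic (nbh (A i) d) (f i x) < r) small_scales_filter.
  have usc i : \forall y \near x & d \near small_scales,
      nbh (A i) d (f i y) -> A i (f i x).
    have [Afx|nAfx] := pselect (A i (f i x)); first exact: filterE.
    have /nbhs_mdistP[e /= e0 eA] : nbhs (f i x) (~` A i).
      by apply: open_nbhs_nbhs; split=> //; apply: closed_openC.
    have e2 : 0 < e / 2 by rewrite divr_gt0.
    exists ([set y | mdist (f i x) (f i y) < e / 2], [set d | 0 < d < e / 2]).
      split=> /=; last by exists (e / 2).
      have : nbhs (f i x) [set z | mdist (f i x) z < e / 2].
        by apply/nbhs_mdistP; exists (e / 2).
      by move/(cf i x).
    move=> [y d] /= [xy /andP[d0 de]] [a Aa ay].
    have /eA // : mdist (f i x) a < e.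
    apply: le_lt_trans (metric_triangle _ (f i y) _) _.
    by rewrite (metric_sym (f i y)); lra.
  have : \forall y \near x & d \near small_scales,
      forall i, nbh (A i) d (f i y) -> A i (f i x).
    have FF : Filter (filter_prod (nbhs x) small_scales).
      exact: filter_prod_filter.
    exact: filter_forall FF usc.
  apply: filterS => -[y d] /= H; apply: le_lt_trans (lt_r x Dx).
  by apply: ler_sum => i _; apply: ind_le; apply: H.
exists (e / 2); first by rewrite divr_gt0.
by apply: He => /=; apply/andP; split; lra.
Qed.

(** The points of [A] cannot lie in all the complements of the [U l]: this is a
    bound on a sum of indicators, to which the thickening lemma applies. *)
Lemma lebesgue_number (L : finType) (A : set X) (U : L -> set X) :
  compact A -> (forall l, open (U l)) ->
  (forall x, A x -> exists l, U l x) ->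
  exists2 d : R, 0 < d & forall x, A x -> exists l,
    forall y, mdist x y < d -> U l y.
Proof.
move=> cA oU AU.
have [l|l|x Ax|d d0 Hd] := @nbh_sum_lt L (fun l => ~` U l)
  (fun _ x => x) A #|L|%:R cA.
- exact: open_closedC.
- by move=> x.
- have [l Ul] := AU x Ax.
  rewrite -sum1_card natr_sum (bigD1 l) //= [ltRHS](bigD1 l) //=.
  apply: ltr_leD; first by rewrite ind_out ?ltr01 //; apply.
  by apply: ler_sum => l' _; apply: ind_le1.
exists d => // x Ax; apply: contrapT => nl; have := Hd x Ax.
apply/negP; rewrite -leNgt -sum1_card natr_sum; apply: ler_sum => l _.
rewrite ind_in //; apply: contrapT => nx; apply: nl; exists l => y xy.
apply: contrapT => nU; apply: nx; exists y => //.
by rewrite metric_sym.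
Qed.

End Neighbourhoods.

Section OpenSets.
Variables (X : topologicalType).

Lemma open_and (P : Prop) (A : set X) : open A -> open [set x | P /\ A x].
Proof.
have [p|np] := pselect P => oA.
  suff -> : [set x | P /\ A x] = A by [].
  by apply/seteqP; split=> x //= -[].
suff -> : [set x | P /\ A x] = set0 by exact: open0.
by apply/seteqP; split=> x //= -[].
Qed.

Lemma open_preimage (f : X -> X) (A : set X) :
  continuous f -> open A -> open [set x | A (f x)].
Proof. by move=> cf oA; apply: open_comp => // x _; apply: cf. Qed.

Lemma closed_preimage (f : X -> X) (A : set X) :
  continuous f -> closed A -> closed [set x | A (f x)].
Proof. by move=> cf; rewrite -!openC => oA; apply: (open_preimage cf oA). Qed.

End OpenSets.

Section Comparison.
Variables (R : realType) (G : groupType) (X : metricType R).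
Variable (act : G -> X -> X).
Hypothesis act1 : forall x, act 1%g x = x.
Hypothesis actM : forall g h x, act (g * h)%g x = act g (act h x).
Hypothesis act_cont : forall g, continuous (act g).
Hypothesis X_compact : compact [set: X].
Implicit Types (N M : {pred G}) (K : {fset G}).

(** Closedness makes a strict density bound robust: finitely many translates
    witness it at every point, and by compactness some thickening of the sets
    still satisfies it at every point. *)
Lemma mean_le_nbh N (L : finType) (A : L -> set X) (r r' : R) :
  (forall x, x \in N -> (x^-1)%g \in N) -> has_folner R N ->
  (forall l, closed (A l)) -> r < r' ->
  mean_le act N (fun x => \sum_l indic (A l) x) (fun=> r) ->
  exists2 d : R, 0 < d &
    mean_le act N (fun x => \sum_l indic (nbh (A l) d) x) (fun=> r').
Proof.
move=> NV FN cA rr D.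
have rm : r < (r + r') / 2 < r' by apply/andP; split; lra.
case/andP: rm; set m := (r + r') / 2 => rm mr.
have [T [TN T0 HT]] := mean_le_finite_witness FN rm D.
have cT : 0 < #|` T|%:R :> R by rewrite ltr0n cardfs_gt0.
have sumE (B : L -> set X) x :
    \sum_(i : T * L) indic (B i.2) (act (val i.1) x) =
    \sum_(t <- T) \sum_l indic (B l) (act t x) :> R.
  rewrite big_seq_fsetE /= pair_bigA //=.
have [x _|d d0 Hd] := @nbh_sum_lt R X (T * L)%type (fun i => A i.2)
  (fun i => act (val i.1)) setT (r' * #|` T|%:R) X_compact
  (fun i => cA i.2) (fun i => @act_cont (val i.1)).
  by rewrite sumE; apply: le_lt_trans (HT x) _; rewrite ltr_pM2r.
exists d => //.
pose f x : R := \sum_l indic (nbh (A l) d) x.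
have f_bound x : 0 <= f x <= #|L|%:R.
  rewrite sumr_ge0 => [/=|l _]; last exact: ind_ge0.
  rewrite -sum1_card natr_sum.
  by apply: ler_sum => l _; apply: ind_le1.
have TV k : k \in T -> (k^-1)%g \in N by move=> /TN /NV.
have c0 : 0 <= #|` T|%:R^-1 :> R by rewrite invr_ge0 ltW.
have /(mean_le_scale c0) D' := mean_le_average act1 actM TV f_bound.
apply: mean_le_trans (mean_le_trans _ D') _; apply: mean_leW => x.
  by rewrite mulrA mulVf ?mul1r ?gt_eqF.
by rewrite mulrC ler_pdivrMr // -sumE ltW // Hd.
Qed.

End Comparison.

(** * Comparison for families of sets *)

Lemma injection_of_size (T U : eqType) (u0 : U) (D : seq T) (E : seq U) :
  (size D <= size E)%N -> uniq E ->
  exists f : T -> U, (forall x, x \in D -> f x \in E) /\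
    {in D &, injective f}.
Proof.
move=> DE uE; exists (fun x => nth u0 E (index x D)).
have lt x : x \in D -> (index x D < size E)%N.
  by rewrite -index_mem => h; apply: leq_trans h DE.
split=> [x xD|x y xD yD /eqP]; first by rewrite mem_nth ?lt.
rewrite nth_uniq ?lt // => /eqP xy.
by rewrite -(nth_index x xD) xy nth_index.
Qed.

Section LabelledComparison.
Variables (R : realType) (G : groupType) (X : metricType R).
Variable (act : G -> X -> X).
Hypothesis act1 : forall x, act 1%g x = x.
Hypothesis actM : forall g h x, act (g * h)%g x = act g (act h x).
Hypothesis act_cont : forall g, continuous (act g).
Hypothesis X_compact : compact [set: X].
Implicit Types (N M : {pred G}) (K : {fset G}).

Lemma almost_finite_folner N :
  inhabited X -> almost_finite_along act N -> has_folner R N.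
Proof.
move=> [x] AF K d KN d0.
have [I [J [S [S' [V [W [h C]]]]]]] := AF K d KN d0.
have [i] : inhabited I.
  case: (rest_cover C x) => [[i _]//|[j /(rest_to_part C)[i _]]//].
by exists (S i); [apply: castle_in C _|apply: castle_folner C _].
Qed.

(** Subequivalence of families, as in the type semigroup of the action: the
    pieces that cover [A l] may go to several of the sets [B l'], and images
    have to be disjoint only when they lie in the same [B l']. *)
Record labelled_subequiv N (L : Type) (A B : L -> set X) (J : finType)
    (W : J -> set X) (h : J -> G) (a b : J -> L) : Prop := {
  piece_open : forall j, open (W j);
  piece_in : forall j, h j \in N;
  piece_cover : forall l x, A l x -> exists j, a j = l /\ W j x;
  piece_to : forall j x, W j x -> B (b j) (act (h j) x);
  piece_disjoint : forall j j' x x', W j x -> W j' x' -> b j = b j' ->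
    act (h j) x = act (h j') x' -> j = j' }.

Section TowerCount.
Variables (L : finType) (S S' : {fset G}) (V : set X).
Variables (A B : L -> set X) (e d r : R).

(** In one tower, the copies of the level [s] are counted once for each index
    [l]: [sources] are the copies that have to be moved, [targets] those that
    can receive a level, and [part_slots] those where the remainder lands. *)
Definition slots := [seq (s, l) | s <- enum_fset S, l <- enum L].
Definition sources :=
  [seq p <- slots | `[< exists2 v, V v & A p.2 (act p.1 v) >]].
Definition targets :=
  [seq p <- slots | `[< forall v, V v -> B p.2 (act p.1 v) >]].
Definition part_slots := [seq (s, l) | s <- enum_fset S', l <- enum L].

Lemma mem_slots p : (p \in slots) = (p.1 \in S).
Proof.
apply/allpairsP/idP => [[q [qS _ ->]] //|pS].
by exists p; split; rewrite ?mem_enum //; case: p pS.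
Qed.

Lemma mem_part_slots p : (p \in part_slots) = (p.1 \in S').
Proof.
apply/allpairsP/idP => [[q [qS _ ->]] //|pS].
by exists p; split; rewrite ?mem_enum //; case: p pS.
Qed.

Lemma uniq_targets : uniq targets.
Proof.
apply: filter_uniq; apply: allpairs_uniq.
- exact: fset_uniq.
- exact: enum_uniq.
- by move=> [s l] [s' l'] _ _ [-> ->].
Qed.

Lemma size_slots : size slots = (#|` S| * #|L|)%N.
Proof. by rewrite size_allpairs -cardE. Qed.

Lemma sum_slots (f : G -> L -> R) :
  \sum_(p <- slots) f p.1 p.2 = \sum_(s <- S) \sum_l f s l.
Proof.
rewrite big_allpairs_dep /=; apply: eq_bigr => s _.
by rewrite big_enum.
Qed.

Lemma size_sub_slots (P : G * L -> Prop) :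
  (size [seq p <- slots | `[< P p >]])%:R =
  \sum_(p <- slots) `[< P p >]%:R :> R.
Proof.
rewrite size_filter -sum1_count natr_sum big_mkcond.
by apply: eq_bigr => p _; case: ifP.
Qed.

Hypothesis small : forall s x y, s \in S -> V x -> V y ->
  mdist (act s x) (act s y) < d.
Hypothesis dens : forall x, \sum_(s <- S)
  (\sum_l indic (nbh (A l) d) (act s x) +
   \sum_l indic (nbh (~` B l) d) (act s x)) <= (#|L|%:R - r) * #|` S|%:R.
Hypothesis S'S : {subset S' <= S}.
Hypothesis S'r : #|L|%:R * #|` S'|%:R <= r * #|` S|%:R.

(** A level of diameter less than [d] meeting [A l] lies in its
    [d]-neighbourhood, and one not contained in [B l] lies in that of the
    complement; so at a base point the density bound counts levels. *)
Lemma sources_le_targets : (size sources + size part_slots <= size targets)%N.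
Proof.
have sS' : size part_slots = (#|` S'| * #|L|)%N.
  by rewrite size_allpairs -cardE.
have cS' : (#|` S'| <= #|` S|)%N.
  by apply: fsubset_leq_card; apply/fsubsetP.
have [[v Vv]|nV] := pselect (exists v, V v); last first.
  have -> : sources = [::].
    apply/eqP; rewrite -size_eq0 size_filter; apply/eqP.
    rewrite -(count_pred0 slots); apply: eq_count => p /=.
    by apply: asboolF => -[v Vv _]; apply: nV; exists v.
  have -> : targets = slots.
    rewrite /targets; apply/all_filterP/allP => p _; apply/asboolP => v Vv.
    by case: nV; exists v.
  by rewrite size_slots sS' add0n leq_mul2r cS' orbT.
have h1 : (size sources)%:R <=
    \sum_(s <- S) \sum_l indic (nbh (A l) d) (act s v) :> R.
  rewrite size_sub_slots.
  rewrite -(sum_slots (fun s l => indic (nbh (A l) d) (act s v))).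
  rewrite big_seq [leRHS]big_seq; apply: ler_sum => -[s l] /=.
  rewrite mem_slots => /= sS.
  have -> : `[< exists2 w, V w & A l (act s w) >]%:R =
    indic [set _ : X | exists2 w, V w & A l (act s w)] v :> R by [].
  by apply: ind_le => -[w Vw Aw]; exists (act s w) => //; apply: small.
have h2 : (size slots)%:R - (size targets)%:R <=
    \sum_(s <- S) \sum_l indic (nbh (~` B l) d) (act s v) :> R.
  rewrite size_sub_slots.
  rewrite -(sum_slots (fun s l => indic (nbh (~` B l) d) (act s v))).
  rewrite -sum1_size natr_sum -sumrB.
  rewrite big_seq [leRHS]big_seq; apply: ler_sum => -[s l] /=.
  rewrite mem_slots => /= sS.
  set Q := forall w, _.
  have -> : `[< Q >]%:R = indic [set _ : X | Q] v :> R by [].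
  rewrite -indC; apply: ind_le => /= nQ.
  move: nQ => /existsNP[w /not_implyP[Vw nB]].
  by exists (act s w) => //; apply: small.
have := dens v; rewrite big_split /= => h3.
rewrite -(ler_nat R) natrD sS' natrM.
move: h2; rewrite size_slots natrM => h2.
apply: le_trans (lerD h1 (le_trans _ S'r)) _; first by rewrite mulrC.
by move: h2 h3; rewrite mulrBl; lra.
Qed.

End TowerCount.

(** Tower by tower, [sources_le_targets] provides an injection of the sources
    and of the copies of the part [S'] into the targets. A source is a level and
    is moved at once; a piece of the remainder first moves into a level of the
    part, by the castle, and then follows the injection. *)
Lemma labelled_comparison N (L : finType) (A B : L -> set X) (c : R) :
  normal_subg N -> almost_finite_along act N ->
  (forall l, closed (A l)) -> (forall l, open (B l)) -> 0 < c ->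
  mean_le act N (fun x => \sum_l indic (A l) x)
                (fun x => \sum_l indic (B l) x - c) ->
  exists (J : finType) W h a b, @labelled_subequiv N L A B J W h a b.
Proof.
move=> [N1 NM NV _] AF cA oB c0 D.
have [[[x0] [l0]]|empty] := pselect (inhabited X /\ inhabited L); last first.
  exists void, (fun=> set0), (fun=> 1%g), (@of_void L), (@of_void L).
  by split=> [[]|[]|l x _|[]|[]]; case: empty.
have FN := almost_finite_folner (inhabits x0) AF.
(* The complements of the [B l] are closed, so that both families can be
   thickened simultaneously. *)
pose A2 (p : bool * L) := if p.1 then ~` B p.2 else A p.2.
have sumA2 (U : bool * L -> set X) x : \sum_p indic (U p) x =
    \sum_l indic (U (false, l)) x + \sum_l indic (U (true, l)) x :> R.
  rewrite (eq_bigr (fun p => indic (U (p.1, p.2)) x)); last by case.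
  rewrite -(pair_bigA _ (fun b l => indic (U (b, l)) x)) /=.
  by rewrite big_bool addrC.
have cA2 p : closed (A2 p).
  by rewrite /A2; case: ifP => _ //; apply: open_closedC.
have D2 : mean_le act N (fun x => \sum_p indic (A2 p) x) (fun=> #|L|%:R - c).
  have D1 := mean_le_add D (mean_leW act N
    (f := fun x => #|L|%:R - \sum_l indic (B l) x) (fun x => lexx _)).
  apply: mean_le_trans (mean_le_trans _ D1) _; apply: mean_leW => x.
    rewrite sumA2 lerD2l /A2 /=.
    under eq_bigr do rewrite indC.
    by rewrite sumrB sumr_const.
  lra.
have c2 : #|L|%:R - c < #|L|%:R - c / 2 by lra.
have [d d0 Dd] := mean_le_nbh act1 actM act_cont X_compact NV FN cA2 c2 D2.
have L0 : 0 < #|L|%:R :> R by rewrite ltr0n; apply/card_gt0P; exists l0.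
have r0 : 0 < c / 4 by rewrite divr_gt0.
have [K [d' [KN d'0 HK]]] := Dd _ r0.
(* Levels are thinner than the thickening, shapes are invariant enough for the
   strict inequality, and [#|L|] copies of the part fit into the gap. *)
pose e := Num.min d (Num.min d' (c / 4 / #|L|%:R)).
have e0 : 0 < e by rewrite !lt_min d0 d'0 divr_gt0.
have [ed ed' eL] : [/\ e <= d, e <= d' & e <= c / 4 / #|L|%:R].
  by rewrite /e !ge_min !lexx !orbT.
have [I [J [S [S' [V [W0 [h0 C]]]]]]] := AF K e KN e0.
have S'S := part_sub C.
pose Dl i := [seq inl p | p <- sources (S i) (V i) A] ++
            [seq inr p | p <- part_slots L (S' i)].
have [i|tau Htau] := @choice I ((G * L) + (G * L) -> G * L) (fun i f =>
    (forall x, x \in Dl i -> f x \in targets (S i) (V i) B) /\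
    {in Dl i &, injective f}).
  apply: (injection_of_size (1%g, l0)); last exact: uniq_targets.
  rewrite size_cat !size_map.
  apply: (sources_le_targets (d := d) (r := c / 4)) => //.
  - by move=> s x y sS Vx Vy; apply: lt_le_trans (castle_small C sS Vx Vy) ed.
  - move=> x.
    have FK := folner_weaken (fun k (kK : k \in K) => kK) ed'
      (castle_folner C i).
    have := HK (S i) (fun t tS => castle_in C tS) FK x.
    under eq_bigr do rewrite sumA2 /A2 /=.
    by rewrite sumr_const_fset; lra.
  - have := part_small C i => h; rewrite mulrC -ler_pdivlMr //.
    apply: le_trans h _; rewrite mulrAC ler_wpM2r //.
pose U := \big[fsetU/fset0]_(i : I) S i.
have SU i s : s \in S i -> s \in U 
  by move=> sS; apply/bigfcupP; exists i; rewrite ?mem_index_enum.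
(* The pieces are indexed by a tower, one of its levels, a label and, for pieces
   of the remainder, an index [j] of the castle; indices that do not correspond
   to a slot get the empty set. *)
pose Wo (o : option J) := if o is Some j then W0 j else setT.
pose ho (o : option J) := if o is Some j then h0 j else 1%g.
pose slot (p : I * U * L * option J) : (G * L) + (G * L) :=
  let s := (val p.1.1.2, p.1.2) in if p.2 is Some _ then inr s else inl s.
pose im p := tau p.1.1.1 (slot p).
pose W p := [set x | slot p \in Dl p.1.1.1 /\ (Wo p.2 `&`
  [set x | V p.1.1.1 (act (val p.1.1.2)^-1%g (act (ho p.2) x))]) x].
pose h p := if slot p \in Dl p.1.1.1 then
  ((im p).1 * (val p.1.1.2)^-1 * ho p.2)%g else 1%g.
have im_target p : slot p \in Dl p.1.1.1 ->
    im p \in targets (S p.1.1.1) (V p.1.1.1) B by apply: (Htau p.1.1.1).1.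
have im_in p : slot p \in Dl p.1.1.1 -> (im p).1 \in S p.1.1.1.
  by move=> /im_target; rewrite mem_filter mem_slots => /andP[].
have image p x : W p x -> act (h p) x =
    act (im p).1 (act (val p.1.1.2)^-1%g (act (ho p.2) x)).
  by move=> [sp _]; rewrite /h sp !actM.
exists (I * U * L * option J)%type, W, h, (fun p => p.1.2), (fun p => (im p).2).
split.
- move=> p; apply: open_and; apply: openI.
    by rewrite /Wo; case: p.2 => [j|]; [apply: rest_open C _|apply: openT].
  have oV := open_preimage (@act_cont (val p.1.1.2)^-1%g)
    (castle_open C p.1.1.1).
  exact: (open_preimage (@act_cont (ho p.2)) oV).
- move=> p; rewrite /h; case: ifP => // sp; apply: (NM); first apply: (NM).
  + exact: (castle_in C (im_in _ sp)).
  + by apply: NV; case/bigfcupP: (valP p.1.1.2) => i _ /(castle_in C).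
  + by case: p.2 => [j|] //=; apply: rest_in C _.
- move=> l x Ax; case: (rest_cover C x) => [[i [s [sS Vs]]]|[j Wj]].
    exists (i, FSetSub (SU _ _ sS), l, None); split=> //; split=> //=.
      rewrite mem_cat; apply/orP; left; apply/mapP; exists (s, l) => //.
      rewrite mem_filter mem_slots sS andbT; apply/asboolP.
      by exists (act s^-1%g x) => //=; rewrite actVK.
    by split=> //; rewrite act1.
  have [i [s [sS Vs]]] := rest_to_part C Wj.
  exists (i, FSetSub (SU _ _ (S'S _ _ sS)), l, Some j); split=> //; split=> //=.
  rewrite mem_cat; apply/orP; right; apply/mapP; exists (s, l) => //.
  by rewrite mem_part_slots.
- move=> p x Wp; rewrite image //; have [sp [_ Vp]] := Wp.
  by have := im_target _ sp; rewrite mem_filter => /andP[/asboolP H _];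
    apply: H.
- move=> p p' x x' Wp Wp' bb; rewrite !image //.
  have [sp [Wx Vp]] := Wp; have [sp' [Wx' Vp']] := Wp'.
  move=> eqi; have [ii tt] := castle_disjoint C (im_in _ sp) (im_in _ sp')
    Vp Vp' eqi.
  move: eqi; rewrite tt => /(act_inj act1 actM) eqs.
  have : slot p = slot p'.
    apply: (Htau p.1.1.1).2 => //; first by rewrite ii.
    have : im p = im p'.
      by move: tt bb; case: (im p) (im p') => [? ?] [? ?] /= -> ->.
    by rewrite /im ii.
  case: p p' ii Wx Wx' eqs {Wp Wp' bb tt sp sp' Vp Vp'}
    => [[[i s] l] o] [[[i' s'] l'] o'] /= <-.
  rewrite /slot /=; case: o o' => [j|] [j'|] //= Wx Wx' eqs [/val_inj ss ->].
    rewrite ss in eqs *; move/(act_inj act1 actM) in eqs.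
    by rewrite (rest_disjoint C Wx Wx' eqs).
  by rewrite ss.
Qed.

End LabelledComparison.

(** * Comparison for the ambient group *)

Lemma count_residue (q r n : nat) : (r < q)%N ->
  count (fun i => i %% q == r)%N (iota 0 n) = ((n + (q.-1 - r)) %/ q)%N.
Proof.
move=> rq; have q0 : (0 < q)%N by case: q rq.
elim: n => [|n IH]; first by rewrite /= divn_small // add0n; lia.
rewrite -addn1 iotaD count_cat IH /= addn0 add0n addnAC addn1 divnS // addnC.
congr (nat_of_bool _ + _)%N.
have -> : (n + (q.-1 - r)).+1 = (n + q - r)%N by lia.
have rn : (r <= n + q)%N by lia.
by rewrite -eqn_mod_dvd // modnDr eq_sym (modn_small rq) eq_sym.
Qed.

Lemma equitable_colouring (T : choiceType) (L : finType) (l0 : L)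
    (Q : {fset T}) :
  exists c : T -> L, forall l,
    (#|` [fset x in Q | c x == l]%fset| * #|L| <= #|` Q| + #|L|)%N /\
    (#|` Q| <= #|` [fset x in Q | c x == l]%fset| * #|L| + #|L|)%N.
Proof.
have q0 : (0 < #|L|)%N by apply/card_gt0P; exists l0.
exists (fun x => nth l0 (enum L) (index x (enum_fset Q) %% #|L|)) => l.
have rq : (index l (enum L) < #|L|)%N by rewrite cardE index_mem mem_enum.
rewrite card_fset_filter.
have -> : count (fun x => nth l0 (enum L) (index x Q %% #|L|) == l) Q =
    count (fun i => i %% #|L| == index l (enum L))%N (iota 0 #|` Q|).
  have [->|[x0 _]] := fset_0Vmem Q; first by rewrite cardfs0.
  rewrite -[X in count _ X](mkseq_nth x0) count_map.
  apply: eq_in_count => i; rewrite mem_iota add0n => /andP[_ iQ] /=.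
  rewrite index_uniq ?fset_uniq //.
  have iq : (i %% #|L| < size (enum L))%N by rewrite -cardE ltn_mod.
  apply/eqP/eqP => [<-|->]; last by rewrite nth_index ?mem_enum.
  by rewrite index_uniq ?enum_uniq.
rewrite count_residue //.
have := divn_eq (#|` Q| + (#|L|.-1 - index l (enum L))) #|L|.
have := ltn_pmod (#|` Q| + (#|L|.-1 - index l (enum L))) q0.
set a := (_ %/ _)%N; set b := (_ %% _)%N; lia.
Qed.

Section Comparison.
Variables (R : realType) (G : groupType) (X : metricType R).
Variable (act : G -> X -> X).
Hypothesis act1 : forall x, act 1%g x = x.
Hypothesis actM : forall g h x, act (g * h)%g x = act g (act h x).
Hypothesis act_cont : forall g, continuous (act g).
Hypothesis X_compact : compact [set: X].
Implicit Types (N M : {pred G}) (K : {fset G}).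

Lemma dyn_subequiv_of_pieces (J : finType) (W : J -> set X) (g : J -> G)
    (A B : set X) :
  (forall j, open (W j)) -> (forall x, A x -> exists j, W j x) ->
  (forall j x, W j x -> B (act (g j) x)) ->
  (forall j j' x x', W j x -> W j' x' -> act (g j) x = act (g j') x' ->
    j = j') ->
  dyn_subequiv act A B.
Proof.
move=> oW cW WB dW K _ KA.
exists #|J|, (fun i => W (enum_val i)), (fun i => g (enum_val i)); split=> //.
- move=> x /KA /cW[j Wj]; exists (enum_rank j) => //.
  by rewrite enum_rankK.
- move=> i i' _ _ [z [[x Wx <-] [x' Wx' eqx]]].
  by apply: enum_val_inj; apply: dW Wx Wx' _.
- by move=> i z [x Wx <-]; apply: WB.
Qed.

Lemma open_foot (I : finType) (T : I -> {fset G}) (V : I -> set X) :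
  (forall i, open (V i)) -> open (foot act V T).
Proof.
move=> oV.
have -> : foot act V T =
    \bigcup_(p in [set p : I * G | p.2 \in T p.1])
      [set y | V p.1 (act p.2^-1%g y)].
  apply/seteqP; split=> y /= [].
    by move=> i [s [sT Vs]]; exists (i, s).
  by move=> [i s] /= sT Vs; exists i, s.
by apply: bigcup_open => p _; apply: (open_preimage (@act_cont _)).
Qed.

(** The shrunken sets consist of the points whose ball of radius the Lebesgue
    number of the cover stays in the given open set. *)
Lemma closed_shrinking (L : finType) (A : set X) (U : L -> set X) :
  closed A -> (forall l, open (U l)) ->
  (forall x, A x -> exists l, U l x) ->
  exists A' : L -> set X, [/\ forall l, closed (A' l),
    forall l, A' l `<=` U l & forall x, A x -> exists l, A' l x].
Proof.
move=> cA oU AU.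
have compA : compact A by apply: subclosed_compact cA X_compact _.
have [d d0 Hd] := lebesgue_number compA oU AU.
exists (fun l => ~` nbh (~` U l) d); split.
- by move=> l; apply: open_closedC; apply: open_nbh.
- move=> l x nx; apply: contrapT => nU; apply: nx; exists x => //.
  by rewrite mdistxx.
- move=> x /Hd[l Hl]; exists l => -[y nU yx]; apply: nU; apply: Hl.
  by rewrite metric_sym.
Qed.

(** The cut of [A] and [B] into [#|T|] parts of almost equal mean. The levels
    that meet [A], and independently those contained in [B], are coloured by
    [T]. Rounding costs at most one level per tower and colour, hence at most
    [e2] in the mean when the towers have at least [1 / e2] levels. *)
Section ColouredTowers.
Variables (N : {pred G}) (T : {fset G}) (e e2 d : R) (A B : set X).
Variables (I J : finType) (S S' : I -> {fset G}) (V : I -> set X).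
Variables (W : J -> set X) (h : J -> G) (K : {fset G}).
Hypothesis normalN : normal_subg N.
Hypothesis C : exhausting_castle act N K e S S' V W h.
Hypothesis T0 : T != fset0.
Hypothesis e0 : 0 < e.
Hypothesis ed : e <= d.
Hypothesis e20 : 0 <= e2.
Hypothesis S_large : forall i, 1 <= e2 * #|` S i|%:R.

Let q : R := #|` T|%:R.

Definition meeting i :=
  [fset s in S i | `[< exists2 v, V i v & A (act s v) >]]%fset.
Definition inside i :=
  [fset s in S i | `[< forall v, V i v -> B (act s v) >]]%fset.

Lemma meeting_sub i : {subset meeting i <= S i}.
Proof. by move=> s; rewrite !inE => /andP[]. Qed.

Lemma inside_sub i : {subset inside i <= S i}.
Proof. by move=> s; rewrite !inE => /andP[]. Qed.

Variables (alpha beta : I -> G -> T).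

Definition meeting_of (l : T) i := [fset s in meeting i | alpha i s == l]%fset.
Definition inside_of (l : T) i := [fset s in inside i | beta i s == l]%fset.

Hypothesis alphaP : forall i l,
  (#|` meeting_of l i| * #|` T| <= #|` meeting i| + #|` T|)%N.
Hypothesis betaP : forall i l,
  (#|` inside i| <= #|` inside_of l i| * #|` T| + #|` T|)%N.

Lemma meeting_of_sub l i : {subset meeting_of l i <= S i}.
Proof. by move=> s; rewrite inE /= => /andP[/meeting_sub]. Qed.

Lemma inside_of_sub l i : {subset inside_of l i <= S i}.
Proof. by move=> s; rewrite inE /= => /andP[/inside_sub]. Qed.

Let q0 : 0 < q. Proof. by rewrite ltr0n cardfs_gt0. Qed.

Let SN i : {subset S i <= N}.
Proof. by move=> s sS; apply: (castle_in C sS). Qed.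

Lemma mean_le_level_mass g :
  mean_le act N (fun x => e2 * \sum_i #|` S i|%:R * indic (V i) (act g x))
            (fun=> e2).
Proof.
have SS i : {subset S i <= S i} by [].
have D := mean_le_levels_foot (R := R) act1 actM (castle_disjoint C) SS
  normalN SN g.
apply: mean_le_trans (mean_le_scale e20 D) _; apply: mean_leW => x.
by rewrite ler_piMr // ind_le1.
Qed.

Lemma mean_le_meeting_of l g :
  mean_le act N (fun x => indic (foot act V (meeting_of l)) (act g x))
            (fun x => q^-1 * indic (nbh A d) (act g x) + e2).
Proof.
have sub i : {subset meeting_of l i <= N} by move=> s /meeting_of_sub /SN.
have subQ i : {subset meeting i <= N} by move=> s /meeting_sub /SN.
apply: mean_le_trans (mean_le_foot_levels act1 actM (castle_disjoint C)
  (@meeting_of_sub l) normalN sub g) _.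
apply: (mean_le_trans (g := fun x =>
    q^-1 * (\sum_i #|` meeting i|%:R * indic (V i) (act g x)) +
    e2 * \sum_i #|` S i|%:R * indic (V i) (act g x))).
  apply: mean_leW => x; rewrite !mulr_sumr -big_split /=; apply: ler_sum => i _.
  rewrite !mulrA -mulrDl; apply: ler_wpM2r; first exact: ind_ge0.
  have := alphaP i l; rewrite -(ler_nat R) natrM natrD -/q -ler_pdivlMr //.
  move=> /le_trans; apply; rewrite mulrDl divff ?gt_eqF // mulrC lerD2l.
  exact: S_large.
have qV0 : 0 <= q^-1 by rewrite invr_ge0 ltW.
apply: (mean_le_trans (mean_le_add (mean_le_scale qV0
  (mean_le_levels_foot act1 actM (castle_disjoint C) (@meeting_sub) normalN
    subQ g)) (mean_le_level_mass g))).
apply: mean_leW => x; rewrite lerD2r ler_wpM2l //; apply: ind_le.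
move=> [i [s [sQ Vs]]]; move: sQ; rewrite inE /= => /andP[sS /asboolP[v Vv Av]].
exists (act s v) => //; rewrite -(actVK act1 actM s (act g x)).
exact: lt_le_trans (castle_small C sS Vv Vs) ed.
Qed.

Lemma mean_le_inside_of l g :
  mean_le act N (fun x => q^-1 * (1 - indic (nbh (~` B) d) (act g x)))
            (fun x => indic (foot act V (inside_of l)) (act g x) + (e2 + e)).
Proof.
have sub i : {subset inside_of l i <= N} by move=> s /inside_of_sub /SN.
have subQ i : {subset inside i <= N} by move=> s /inside_sub /SN.
have q1 : q^-1 <= 1 by rewrite invf_le1 // ler1n cardfs_gt0.
have qV0 : 0 <= q^-1 by rewrite invr_ge0 ltW.
have NN : {subset N <= N} by [].
apply: (mean_le_trans (g := fun x =>
    q^-1 * indic (foot act V inside) (act g x) +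
    indic (rest W) (act g x))).
  apply: mean_leW => x.
  apply: (@le_trans _ _ (q^-1 * (indic (foot act V inside) (act g x) +
    indic (rest W) (act g x)))); last first.
    by rewrite mulrDr lerD2l ler_piMl // ind_ge0.
  rewrite ler_wpM2l // lerBlDr.
  case: (rest_cover C (act g x)) => [[i [s [sS Vs]]]|[j Wj]]; last first.
    rewrite (ind_in (A := rest W)); last by exists j.
    by rewrite addrAC lerDr addr_ge0 ?ind_ge0.
  have [sB|nB] := pselect (forall v, V i v -> B (act s v)).
    rewrite (ind_in (A := foot _ _ _)).
      by rewrite -addrA lerDl addr_ge0 ?ind_ge0.
    by exists i, s; rewrite !inE /= sS; split=> //; apply/asboolP.
  rewrite (ind_in (A := nbh _ _)); first by rewrite lerDr addr_ge0 ?ind_ge0.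
  move: nB => /existsNP[v /not_implyP[Vv nB]]; exists (act s v) => //.
  rewrite -(actVK act1 actM s (act g x)).
  exact: lt_le_trans (castle_small C sS Vv Vs) ed.
apply: (mean_le_trans (mean_le_add (mean_le_scale qV0
  (mean_le_foot_levels act1 actM (castle_disjoint C) (@inside_sub) normalN
    subQ g))
  (mean_le_rest act1 actM g C NN normalN e0))).
apply: (mean_le_trans (g := fun x =>
    \sum_i #|` inside_of l i|%:R * indic (V i) (act g x) +
    e2 * (\sum_i #|` S i|%:R * indic (V i) (act g x)) + e)).
  apply: mean_leW => x; rewrite lerD2r !mulr_sumr -big_split /=.
  apply: ler_sum => i _.
  rewrite !mulrA -mulrDl; apply: ler_wpM2r; first exact: ind_ge0.
  have := betaP i l; rewrite -(ler_nat R) natrD natrM -/q => h'.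
  apply: (@le_trans _ _ (#|` inside_of l i|%:R + 1)).
    by rewrite mulrC ler_pdivrMr // mulrDl mul1r.
  by rewrite lerD2l; apply: S_large.
apply: mean_le_trans (mean_le_add (mean_le_add (mean_le_levels_foot act1 actM
  (castle_disjoint C) (@inside_of_sub l) normalN sub g) (mean_le_level_mass g))
  (mean_leW act N (fun x : X => lexx e))) _.
by apply: mean_leW => x; rewrite addrA.
Qed.

End ColouredTowers.

Definition arbitrarily_large N : Prop :=
  forall m : nat, exists2 K : {fset G}, {subset K <= N} & (m <= #|` K|)%N.

Lemma comparison N (A B : set X) (c : R) :
  normal_subg N -> almost_finite_along act N -> arbitrarily_large N ->
  has_folner R (predT : {pred G}) -> closed A -> open B -> 0 < c ->
  mean_le act predT (indic A) (fun x => indic B x - c) -> dyn_subequiv act A B.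
Proof.
move=> nN AF LN FG cA oB c0 D.
pose A2 (b : bool) := if b then ~` B else A.
have sumA2 (U : bool -> set X) x :
    \sum_b indic (U b) x = indic (U false) x + indic (U true) x :> R.
  by rewrite big_bool addrC.
have cA2 b : closed (A2 b) by case: b => //; apply: open_closedC.
have D2 : mean_le act predT (fun x => \sum_b indic (A2 b) x) (fun=> 1 - c).
  have D1 := mean_le_add D (mean_leW act predT
    (f := fun x => 1 - indic B x) (fun x => lexx _)).
  apply: mean_le_trans (mean_le_trans _ D1) _; apply: mean_leW => x;
    last by lra.
  by rewrite sumA2 /A2 indC.
have c2 : 1 - c < 1 - c / 2 by lra.
have VT (k : G) : k \in predT -> (k^-1)%g \in predT by [].
have [d d0 Dd] := mean_le_nbh act1 actM act_cont X_compact VT FG cA2 c2 D2.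
have c4 : 1 - c / 2 < 1 - c / 4 by lra.
have [T [_ T0 HT]] := mean_le_finite_witness FG c4 Dd.
have q0 : 0 < #|` T|%:R :> R by rewrite ltr0n cardfs_gt0.
have [l0] : inhabited T by have /fset0Pn[t tT] := T0;
  exact: (inhabits (FSetSub tT)).
(* Rounding and remainder cost [e2 + e <= 2 * e2] for each of the [#|T|] colours
   on both sides, [c / 8] in total: less than the gap [c / 4]. *)
pose e2 := c / (32 * #|` T|%:R).
have e20 : 0 < e2 by rewrite divr_gt0 // mulr_gt0.
have [m Hm] : exists m, 1 <= e2 * m%:R.
  exists (Num.bound e2^-1); rewrite mulrC -ler_pdivrMr // mul1r.
  by apply/ltW/archi_boundP; rewrite invr_ge0 ltW.
have [K KN mK] := LN m.
have K1 : 0 < #|` K|%:R + 1 :> R by rewrite ltr_wpDl.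
pose e := Num.min d (Num.min e2 (#|` K|%:R + 1)^-1).
have e0 : 0 < e by rewrite !lt_min d0 e20 invr_gt0.
have [ed ee2 eK] : [/\ e <= d, e <= e2 & e <= (#|` K|%:R + 1)^-1].
  by rewrite /e !ge_min !lexx !orbT.
have [I [J [S [S' [V [W [h C]]]]]]] := AF K e KN e0.
have S_large i : 1 <= e2 * #|` S i|%:R.
  apply: le_trans Hm _; rewrite ler_pM2l // ler_nat; apply: leq_trans mK _.
  apply: (folner_card (castle_folner C i)).
  apply: (@le_lt_trans _ _ ((#|` K|%:R + 1)^-1 * #|` K|%:R)).
    by rewrite ler_wpM2r.
  by rewrite mulrC ltr_pdivrMr // mul1r ltrDl.
have [alpha Ha] := choice (fun i => equitable_colouring l0 (meeting A S V i)).
have [beta Hb] := choice (fun i => equitable_colouring l0 (inside B S V i)).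
have cT : #|{: T}| = #|` T| by rewrite -cardfE.
have alphaP i l : (#|` meeting_of A S V alpha l i| * #|` T| <=
    #|` meeting A S V i| + #|` T|)%N by rewrite -cT; apply: (Ha i l).1.
have betaP i l : (#|` inside B S V i| <=
    #|` inside_of B S V beta l i| * #|` T| + #|` T|)%N.
  by rewrite -cT; apply: (Hb i l).2.
have q00 : 0 <= e2 by rewrite ltW.
have DA := mean_le_meeting_of nN C T0 ed q00 S_large alphaP.
have DB := mean_le_inside_of nN C T0 e0 ed q00 S_large betaP.
(* Each colour may cover the remainder as well: it is sparse, and this makes the
   sets [U l] an open cover of [A], that can be shrunk to closed sets. *)
pose U l := rest W `|` foot act V (meeting_of A S V alpha l).
pose B' l := foot act V (inside_of B S V beta l).
have oU l : open (U l).
  apply: openU; last by apply: open_foot; apply: (castle_open C).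
  have -> : rest W = \bigcup_(j in setT) W j.
    by apply/seteqP; split=> x /= [j]; [exists j|move=> _; exists j].
  by apply: bigcup_open => j _; apply: (rest_open C).
have AU x : A x -> exists l, U l x.
  move=> Ax; case: (rest_cover C x) => [[i [s [sS Vs]]]|rx].
    exists (alpha i s); right; exists i, s; split=> //; rewrite !inE /= sS eqxx.
    by rewrite andbT; apply/asboolP; exists (act s^-1%g x) => //; rewrite actVK.
  by exists l0; left.
have [A' [cA' A'U AA']] := closed_shrinking cA oU AU.
pose q_inv : R := #|` T|%:R^-1.
pose At l := [set x | A' l (act (val l) x)].
pose Bt l := [set x | B' l (act (val l) x)].
have [||||J' [W' [h' [a [b P]]]]] := @labelled_comparison R G X act act1
  actM act_cont X_compact N T At Bt (c / 8) nN AF.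
- by move=> l; apply: (closed_preimage (@act_cont (val l))).
- move=> l; apply: (open_preimage (@act_cont (val l))).
  by apply: open_foot; apply: (castle_open C).
- by rewrite divr_gt0.
- have qe : #|` T|%:R * (e2 + e) <= c / 16.
    apply: (@le_trans _ _ (#|` T|%:R * (e2 + e2))).
      by rewrite ler_wpM2l // lerD2l.
    have -> : #|` T|%:R * (e2 + e2) = c / 16.
      by rewrite /e2; field; rewrite gt_eqF.
    by [].
  have sumT (k : R) : \sum_(l : T) k = k * #|` T|%:R.
    by rewrite sumr_const cT mulr_natr.
  have NN : {subset N <= N} by [].
  apply: (mean_le_trans (g := fun x => \sum_(l : T)
      (q_inv * indic (nbh A d) (act (val l) x) + e2 + e))).
    apply: mean_le_sum => l _; apply: mean_le_trans (mean_le_add (DA l (val l))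
      (mean_le_rest act1 actM (val l) C NN nN e0)).
    apply: mean_leW => x.
    have := @ind_le_sum R X bool [:: true; false] (At l)
      (fun b => if b then foot act V (meeting_of A S V alpha l) else rest W) x
      (fun _ => act (val l) x).
    rewrite big_cons big_seq1; apply => /A'U[Wx|fx]; first by exists false.
    by exists true.
  apply: (mean_le_trans (g := fun x => \sum_(l : T)
      (q_inv * (1 - indic (nbh (~` B) d) (act (val l) x))) - (c / 4 - c / 16))).
    apply: mean_leW => x; have := HT x.
    under eq_bigr do rewrite sumA2.
    rewrite big_seq_fsetE /= big_split /=.
    under [X in _ -> X <= _]eq_bigr do rewrite -addrA.
    rewrite big_split sumT -!mulr_sumr sumrB sumT mul1r /=.
    set a := \sum_(i : T) indic (nbh A d) _; set b := \sum_(i : T) _ => h1.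
    have : q_inv * (a + b) <= 1 - c / 4.
      by rewrite mulrC ler_pdivrMr.
    rewrite mulrBr mulVf ?gt_eqF // mulrDr [(e2 + e) * _]mulrC; lra.
  apply: mean_le_trans (mean_le_add (mean_le_sum (index_enum _)
    (fun l (_ : xpredT l) => DB l (val l)))
    (mean_leW act N (fun x : X => lexx (- (c / 4 - c / 16))))) _.
  apply: mean_leW => x; rewrite big_split /= sumT mulrC -addrA lerD2l; lra.
apply: (dyn_subequiv_of_pieces
  (W := fun j => [set y | W' j (act (val (a j))^-1%g y)])
  (g := fun j => (val (b j) * h' j * (val (a j))^-1)%g)).
- move=> j; apply: (open_preimage (@act_cont _)); exact: (piece_open P).
- move=> x /AA'[l A'x].
  have [|j [al Wj]] := piece_cover P (l := l) (x := act (val l)^-1%g x).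
    by rewrite /At /= actVK.
  by exists j; rewrite /= al.
- move=> j y /= Wy; rewrite !actM.
  have [i [s [sI Vs]]] := piece_to P Wy.
  move: sI; rewrite !inE /= => /andP[/andP[sS /asboolP sB] _].
  by have := sB _ Vs; rewrite actVK.
- move=> j j' y y' /= Wy Wy'; rewrite !actM => eqy.
  have [i [s [sI Vs]]] := piece_to P Wy.
  have [i' [s' [sI' Vs']]] := piece_to P Wy'.
  move: (sI) (sI'); rewrite !inE /= => /andP[/andP[sS _] /eqP bs].
  move=> /andP[/andP[sS' _] /eqP bs'].
  have [ii ss] : i = i' /\ s = s'.
    by apply: (castle_disjoint C sS sS' Vs Vs'); rewrite !actVK.
  have bb : b j = b j' by rewrite -bs -bs' ii ss.
  apply: (piece_disjoint P Wy Wy' bb).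
  by move: eqy; rewrite bb => /(act_inj act1 actM).
Qed.

End Comparison.

(** * Disjoint small open sets *)

Section FiniteIntersections.
Variables (X : topologicalType) (T : choiceType).

Lemma open_forall_fset (F : {fset T}) (P : T -> set X) :
  (forall f, f \in F -> open (P f)) ->
  open [set x | forall f, f \in F -> P f x].
Proof.
move=> oP; rewrite openE => x Px.
have HF (f : F) : \forall y \near x, P (val f) y.
  apply: open_nbhs_nbhs; split; first exact: oP (valP f).
  by apply: Px; exact: valP f.
have := @filter_forall _ _ (fun f : F => P (val f)) _ (nbhs_filter x) HF.
apply: filterS => y Py f fF.
exact: Py (FSetSub fF).
Qed.

Lemma closed_exists_fset (F : {fset T}) (P : T -> set X) :
  (forall f, f \in F -> closed (P f)) ->
  closed [set x | exists2 f, f \in F & P f x].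
Proof.
move=> cP; rewrite -openC.
have -> : ~` [set x | exists2 f, f \in F & P f x] =
    [set x | forall f, f \in F -> (~` P f) x].
  apply/seteqP; split=> x /=.
    by move=> nP f fF Pf; apply: nP; exists f.
  by move=> nP [f fF]; apply: nP.
by apply: open_forall_fset => f fF; apply: closed_openC; apply: cP.
Qed.

End FiniteIntersections.

Lemma finite_positive_bound (R : realType) (T : eqType) (r : seq T)
    (g : T -> R) (e : R) :
  0 < e -> (forall t, t \in r -> 0 < g t) ->
  exists2 b, 0 < b <= e & forall t, t \in r -> b <= g t.
Proof.
move=> e0; elim: r => [|t r IH] gr; first by exists e; rewrite ?e0 ?lexx.
have [|b /andP[b0 be] Hb] := IH.
  by move=> t' t'r; apply: gr; rewrite inE t'r orbT.
exists (Num.min b (g t)) => [|t'].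
  by rewrite lt_min b0 gr ?mem_head // ge_min be.
by rewrite inE ge_min => /orP[/eqP -> | /Hb ->]; rewrite ?lexx ?orbT.
Qed.

Section Tilings.
Variables (R : realType) (G : groupType) (X : metricType R).
Variable (act : G -> X -> X).
Hypothesis act1 : forall x, act 1%g x = x.
Hypothesis actM : forall g h x, act (g * h)%g x = act g (act h x).
Hypothesis act_cont : forall g, continuous (act g).
Hypothesis act_free : free_action act.
Hypothesis X_compact : compact [set: X].
Implicit Types (N M : {pred G}) (K F L P : {fset G}) (e : R).

Notation meanG_le := (mean_le act (predT : {pred G})).

(** The sets over which a tower with shape [F] has disjoint small levels. *)
Definition small_injective F e (Z : set X) : Prop :=
  (forall f x y, f \in F -> Z x -> Z y -> mdist (act f x) (act f y) < e) /\
  (forall f f' x y, f \in F -> f' \in F -> Z x -> Z y ->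
     act f x = act f' y -> f = f').

Lemma small_injectiveS F e (Z Z' : set X) :
  Z' `<=` Z -> small_injective F e Z -> small_injective F e Z'.
Proof.
move=> ZZ [s1 s2]; split=> [f x y fF /ZZ ? /ZZ ?|]; first exact: s1.
by move=> f f' x y fF fF' /ZZ Zx /ZZ Zy; apply: s2 fF fF' Zx Zy.
Qed.

(** By freeness the finitely many points [f x] are distinct, at distances at
    least some [b > 0]; points near [x] keep their translates within [b / 2]
    of these. *)
Lemma small_injective_nbhd F e x : 0 < e ->
  exists U, [/\ open U, U x & small_injective F e U].
Proof.
move=> e0.
pose r :=
  [seq p <- [seq (f, f') | f <- enum_fset F, f' <- enum_fset F] | p.1 != p.2].
have [p|b /andP[b0 be] Hb] := @finite_positive_bound R _ r
  (fun p => mdist (act p.1 x) (act p.2 x)) e e0.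
  rewrite mem_filter => /andP[p12 _]; rewrite mdist_gt0.
  apply: contra_neq p12 => eq12.
  have [p1|] := eqVneq (p.2^-1 * p.1)%g 1%g.
    by apply: (mulgI p.2^-1%g); rewrite p1 mulVg.
  by move/act_free => /(_ x); rewrite actM eq12 (actK act1 actM).
have b2 : 0 < b / 2 by rewrite divr_gt0.
have near_lt f f' y z : mdist (act f x) (act f y) < b / 2 ->
    mdist (act f' x) (act f' z) < b / 2 -> act f y = act f' z ->
    mdist (act f x) (act f' x) < b.
  move=> h1 h2 eqyz; apply: le_lt_trans (metric_triangle _ (act f y) _) _.
  by rewrite {2}eqyz (metric_sym (act f' z)); lra.
exists [set y | forall f, f \in F -> mdist (act f x) (act f y) < b / 2]; split.
- apply: open_forall_fset => f fF.
  apply: (open_preimage (@act_cont f)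
    (A := [set z | mdist (act f x) z < b / 2])).
  have -> : [set z | mdist (act f x) z < b / 2] = nbh [set act f x] (b / 2).
    apply/seteqP; split=> z /=; first by exists (act f x).
    by move=> [_ ->].
  exact: open_nbh.
- by move=> f _ /=; rewrite mdistxx.
- split=> [f y z fF /(_ f fF) Uy /(_ f fF) Uz|f f' y z fF fF' Uy Uz eqyz].
    apply: le_lt_trans (metric_triangle _ (act f x) _) _.
    by rewrite (metric_sym (act f y)); lra.
  apply/eqP; apply: contraT => ff'.
  have := near_lt f f' y z (Uy f fF) (Uz f' fF') eqyz.
  rewrite ltNge (Hb (f, f')) // mem_filter ff' /=.
  by apply/allpairsP; exists (f, f').
Qed.

Lemma small_injective_cover F e : 0 < e ->
  exists (I : finType) (U : I -> set X), [/\ forall k, open (U k),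
    forall x, exists k, U k x & forall k, small_injective F e (U k)].
Proof.
move=> e0; have [U HU] := choice (fun x => small_injective_nbhd F x e0).
have /compact_near_coveringP cX := X_compact.
pose large : set_system {fset X} :=
  filter_from [set: {fset X}]
    (fun D => [set D' : {fset X} | {subset D <= D'}]).
have large_filter : Filter large.
  apply: filter_from_filter; first by exists fset0.
  move=> D D' _ _; exists (D `|` D')%fset => // D2 /= sD.
  by split=> k kD; apply: sD; rewrite inE kD ?orbT.
have [x _|D _ cD] := cX _ large
    (fun (D : {fset X}) x => exists2 k, k \in D & U k x) large_filter.
  exists (U x, [set D : {fset X} | x \in D]) => /=.
    split; first by case: (HU x) => oU Ux _; apply: open_nbhs_nbhs.
    by exists [fset x]%fset => // D /= sD; apply: sD; rewrite inE.
  by move=> [y D] /= [Uy xD]; exists x.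
exists D, (fun k => U (val k)); split=> [k|x|k]; try by case: (HU (val k)).
have [|k kD Uk] := cD D _ x Logic.I; first by [].
by exists (FSetSub kD).
Qed.

Variable N : {pred G}.
Hypothesis AF : almost_finite_along act N.

Lemma normal_predT : normal_subg (predT : {pred G}). Proof. by []. Qed.

(** The levels of a castle with small levels and sparse remainder, sorted
    according to a member of the cover that contains them. *)
Lemma disjoint_refinement (I : finType) (U : I -> set X) (t : R) :
  (forall k, open (U k)) -> (forall x, exists k, U k x) -> 0 < t ->
  exists Z : I -> set X, [/\ forall k, open (Z k), forall k, Z k `<=` U k,
    forall k k' x, Z k x -> Z k' x -> k = k' &
    meanG_le (indic (~` [set x | exists k, Z k x])) (fun=> t)].
Proof.
move=> oU cU t0.
have [[x0]|nX] := pselect (inhabited X); last first.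
  exists (fun=> set0); split=> [k|k x []|k k' x []|]; first exact: open0.
  by apply: mean_leW => x; case: nX.
have [d d0 Hd] := lebesgue_number X_compact oU (fun x _ => cU x).
pose e : R := Num.min d t.
have e0 : 0 < e by rewrite lt_min d0.
have [ed et] : e <= d /\ e <= t by rewrite /e !ge_min !lexx orbT.
have K0 : {subset (fset0 : {fset G}) <= N} by move=> s; rewrite inE.
have [I' [J [S [S' [V [W [h C]]]]]]] := AF K0 e0.
have [k0 _] := cU x0.
have [p|c Hc] := @choice (I' * G)%type I (fun p k => p.2 \in S p.1 ->
    forall v, V p.1 v -> U k (act p.2 v)).
  have [[v Vv]|nV] := pselect (exists v, V p.1 v); last first.
    by exists k0 => _ v Vv; case: nV; exists v.
  have [k Hk] := Hd (act p.2 v) Logic.I; exists k => pS w Vw; apply: Hk.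
  exact: lt_le_trans (castle_small C pS Vv Vw) ed.
exists (fun k => foot act V (fun i => [fset s in S i | c (i, s) == k]%fset)).
split.
- by move=> k; apply: (open_foot act_cont); apply: (castle_open C).
- move=> k y [i [s [sS Vs]]]; move: sS; rewrite !inE /= => /andP[sS /eqP <-].
  by have := Hc (i, s) sS _ Vs; rewrite /= (actVK act1 actM).
- move=> k k' y [i [s [sS Vs]]] [i' [s' [sS' Vs']]].
  move: sS sS'; rewrite !inE /= => /andP[sS /eqP <-] /andP[sS' /eqP <-].
  have [-> ->] // : i = i' /\ s = s'.
  by apply: (castle_disjoint C sS sS' Vs Vs'); rewrite !(actVK act1 actM).
- apply: (mean_le_trans (g := fun x => indic (rest W) (act 1%g x))).
    apply: mean_leW => x; rewrite act1; apply: ind_le => nZ.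
    case: (rest_cover C x) => // -[i [s [sS Vs]]]; case: nZ.
    by exists (c (i, s)), i, s; rewrite !inE /= sS eqxx.
  have NT : {subset N <= (predT : {pred G})} by [].
  apply: mean_le_trans (mean_le_rest act1 actM 1%g C NT normal_predT e0) _.
  exact: mean_leW.
Qed.

End Tilings.

(** * One step of the greedy algorithm *)

Lemma folner_trim (R : realType) (G : groupType) (K F P : {fset G})
    (d a e : R) :
  folner K d F -> (P `<=` F)%fset -> a < 1 -> 0 <= e ->
  (1 - a) * #|` F|%:R <= #|` P|%:R -> d + a <= e * (1 - a) -> folner K e P.
Proof.
move=> FF PF a1 e0 aP de; have F0 := card_gt0_folner FF.
have a0 : 0 < 1 - a by rewrite subr_gt0.
have P0 : 0 < #|` P|%:R :> R by apply: lt_le_trans aP; rewrite mulr_gt0.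
split=> [|k kK]; first by rewrite -cardfs_gt0 -(ltr_nat R).
have sub : (#|` exit k P| <= #|` exit k F| + #|` (F `\` P)%fset|)%N.
  rewrite -(size_map (fun s => k * s)%g (exit k F)) -size_cat.
  rewrite -(size_map (fun s => k * s)%g (exit k P)).
  apply: uniq_leq_size; first by rewrite map_inj_uniq ?fset_uniq //;
    apply: mulgI.
  move=> t /mapP[s]; rewrite !inE => /andP[sP ksP] ->; rewrite mem_cat.
  have [ksF|ksF] := boolP (k * s \in F)%g.
    by apply/orP; right; rewrite !inE ksP.
  apply/orP; left; apply/mapP; exists s => //.
  by rewrite !inE ksF (fsubsetP PF).
have FP : #|` (F `\` P)%fset|%:R <= a * #|` F|%:R.
  by rewrite cardfsDS // natrB ?fsubset_leq_card //; lra.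
apply: (@le_trans _ _ ((d + a) * #|` F|%:R)).
  rewrite mulrDl; apply: le_trans (lerD (FF.2 k kK) FP).
  by rewrite -natrD ler_nat.
apply: (@le_trans _ _ (e * ((1 - a) * #|` F|%:R))); last by rewrite ler_wpM2l.
by rewrite mulrA ler_wpM2r.
Qed.

(** The set [C] covered so far is open, and clopen away from a closed set [D]
    that will have small mean. Tiles over points of [Z] are added: at each point
    [x] whose orbit [F x] avoids [D], the part of [F] that moves [x] outside [C]
    is locally constant, and is a shape as soon as it is almost all of [F]. *)
Section GreedyStep.
Variables (R : realType) (G : groupType) (X : metricType R).
Variable (act : G -> X -> X).
Hypothesis act1 : forall x, act 1%g x = x.
Hypothesis actM : forall g h x, act (g * h)%g x = act g (act h x).
Hypothesis act_cont : forall g, continuous (act g).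

Notation meanG_le := (mean_le act (predT : {pred G})).

Record partial_castle (K : {fset G}) (e : R) (I : finType) (S : I -> {fset G})
    (V : I -> set X) : Prop := {
  pc_folner : forall i, folner K e (S i);
  pc_open : forall i, open (V i);
  pc_disjoint : disjoint_towers act S V;
  pc_small : forall i s x y,
    s \in S i -> V i x -> V i y -> mdist (act s x) (act s y) < e }.

Variables (K F : {fset G}) (e a : R) (Z E C D : set X).
Variables (I : finType) (S : I -> {fset G}) (V : I -> set X).
Hypothesis old : partial_castle K e S V.
Hypothesis C_foot : C = foot act V S.
Hypothesis closedD : closed D.
Hypothesis closedCD : closed (C `|` D).
Hypothesis Z_open : open Z.
Hypothesis E_closed : closed E.
Hypothesis ZE_closed : closed (Z `|` E).
Hypothesis ZE_disjoint : forall x, Z x -> ~ E x.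
Hypothesis Z_sep : small_injective act F e Z.
Hypothesis trim : forall P : {fset G}, (P `<=` F)%fset ->
  (1 - a) * #|` F|%:R <= #|` P|%:R -> folner K e P.

Definition clear : set X := [set x | forall f, f \in F -> ~ D (act f x)].
Definition free_part (x : X) : {fset G} :=
  [fset f in F | `[< ~ C (act f x) >]]%fset.
Definition enough (P : {fset G}) : bool :=
  (1 - a) * #|` F|%:R <= #|` P|%:R :> R.
Definition with_free_part (P : {fset G}) : set X :=
  [set x | Z x /\ clear x /\ free_part x = P].
Definition new_centres : set X :=
  [set x | Z x /\ clear x /\ enough (free_part x)].
Definition new_covered : set X :=
  C `|` [set y | exists2 f, f \in F & new_centres (act f^-1%g y)].
(** The closed set [E] contains the boundary of [Z]. New centres can appear or
    disappear only at [E] and where the orbit meets [D]; the new tiles are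
    clopen away from the [F]-translates of these sets. *)
Definition new_boundary : set X :=
  D `|` ([set y | exists2 f, f \in F & E (act f^-1%g y)] `|`
         [set y | exists2 f, f \in F &
            exists2 f', f' \in F & D (act f' (act f^-1%g y))]).

Lemma C_open : open C.
Proof. rewrite C_foot; apply: open_foot => //; exact: pc_open old. Qed.

Lemma clear_open : open clear.
Proof.
apply: open_forall_fset => f _.
by apply: (open_preimage (@act_cont f) (A := ~` D)); apply: closed_openC.
Qed.

Lemma free_part_sub x : (free_part x `<=` F)%fset.
Proof. by apply/fsubsetP => f; rewrite !inE => /andP[]. Qed.

Lemma with_free_part_open P : (P `<=` F)%fset -> open (with_free_part P).
Proof.
move=> /fsubsetP PF.
have -> : with_free_part P = Z `&` [set x | forall f, f \in F ->
    (if f \in P then ~` (C `|` D) else C `\` D) (act f x)].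
  apply/seteqP; split=> x.
    move=> [Zx [cx <-]]; split=> //= f fF; rewrite !inE fF /=.
    case: ifP => [/asboolP nC|/negbT/asboolPn/contrapT Cf]; last first.
      by split; [exact: Cf|exact: (cx f fF)].
    by move=> [/nC|/(cx f fF)].
  move=> [Zx H]; split=> //; split=> [f fF Df|].
    by have := H f fF; case: ifP => _; [apply; right|case].
  apply/fsetP => f; rewrite !inE; apply/andP/idP => [[fF /asboolP nC]|fP].
    by have := H f fF; case: ifP => // _ [].
  split; first exact: PF.
  by apply/asboolP => Cf; have := H f (PF f fP); rewrite fP; apply; left.
apply: openI => //; apply: open_forall_fset => f fF.
apply: (open_preimage (@act_cont f)); case: ifP => _; first exact: closed_openC.
by apply: openI; [exact: C_open|exact: closed_openC].
Qed.

Definition new_shapes : {fset {fset G}} :=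
  [fset P in fpowerset F | enough P]%fset.
Definition new_S (i : I + new_shapes) : {fset G} :=
  match i with inl i => S i | inr P => val P end.
Definition new_V (i : I + new_shapes) : set X :=
  match i with inl i => V i | inr P => with_free_part (val P) end.

Lemma new_shapeP (P : new_shapes) : (val P `<=` F)%fset /\ enough (val P).
Proof. by have := valP P; rewrite !inE /= fpowersetE => /andP[]. Qed.

Lemma in_free_part f x : f \in free_part x -> f \in F /\ ~ C (act f x).
Proof. by rewrite !inE => /andP[-> /asboolP]. Qed.

Lemma new_partial_castle : partial_castle K e new_S new_V.
Proof.
have old_new i s x (P : new_shapes) f y : s \in S i -> V i x ->
    f \in val P -> with_free_part (val P) y -> act s x = act f y -> False.
  move=> sS Vx fP [_ [_ yP]] eqxy; move: fP; rewrite -yP => /in_free_part[_].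
  by apply; rewrite C_foot; exists i, s; rewrite -eqxy (actK act1 actM).
split.
- case=> [i|P] /=; first exact: pc_folner old _.
  by have [PF Pe] := new_shapeP P; apply: trim.
- case=> [i|P] /=; first exact: pc_open old _.
  by apply: with_free_part_open; case: (new_shapeP P).
- move=> [i|P] [j|Q] s t x y /= sS tS Vx Vy eqxy.
  + by have [-> ->] := pc_disjoint old sS tS Vx Vy eqxy.
  + by case: (old_new _ _ _ _ _ _ sS Vx tS Vy eqxy).
  + by case: (old_new _ _ _ _ _ _ tS Vy sS Vx (esym eqxy)).
  + have [/fsubsetP PF _] := new_shapeP P; have [/fsubsetP QF _] :=
      new_shapeP Q.
    have [Zx [_ xP]] := Vx; have [Zy [_ yQ]] := Vy.
    have st : s = t by apply: (Z_sep.2 _ _ _ _ (PF _ sS) (QF _ tS) Zx Zy eqxy).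
    split=> //; congr inr; apply: val_inj.
    apply: etrans (esym xP) (etrans _ yQ).
    by move: eqxy; rewrite st => /(act_inj act1 actM) ->.
- move=> [i|P] s x y /=; first by move=> sS Vx Vy;
    exact: (pc_small old sS Vx Vy).
  have [/fsubsetP PF _] := new_shapeP P.
  by move=> /PF sF [Zx _] [Zy _]; apply: Z_sep.1.
Qed.

Lemma new_coveredE : new_covered = foot act new_V new_S.
Proof.
apply/seteqP; split=> y.
  have [Cy _|nCy [//|]] := pselect (C y).
    by move: Cy; rewrite C_foot => -[i [s [sS Vs]]]; exists (inl i), s.
  move=> [f fF [Zf [cf ef]]].
  have fp : free_part (act f^-1%g y) \in new_shapes.
    by rewrite !inE fpowersetE free_part_sub.
  exists (inr (FSetSub fp)), f; split=> //=.
  by rewrite !inE fF; apply/asboolP; rewrite (actVK act1 actM).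
move=> [[i|P] [s [/= sS Vs]]]; first by left; rewrite C_foot; exists i, s.
have [/fsubsetP PF Pe] := new_shapeP P; have [Zs [cs fs]] := Vs.
by right; exists s; [exact: PF|split=> //; split=> //; rewrite fs].
Qed.

Lemma new_boundary_closed : closed new_boundary.
Proof.
apply: closedU => //; apply: closedU; apply: closed_exists_fset => f _.
  exact: (closed_preimage (@act_cont _)).
apply: closed_exists_fset => f' _.
apply: (closed_preimage (@act_cont f^-1%g) (A := [set x | D (act f' x)])).
exact: (closed_preimage (@act_cont _)).
Qed.

Lemma new_covered_boundary_closed : closed (new_covered `|` new_boundary).
Proof.
pose Y := new_centres `|` (E `|` [set x | exists2 f, f \in F & D (act f x)]).
have cY : closed Y.
  rewrite -openC.
  have -> : ~` Y = clear `&` (~` (Z `|` E) `|`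
      \bigcup_(P in [set P | (P `<=` F)%fset /\ ~~ enough P]) with_free_part P).
    apply/seteqP; split=> x.
      move=> nY; have cx : clear x.
        by move=> f fF Df; apply: nY; right; right; exists f.
      split=> //; have [Zx|nZ] := pselect (Z x).
        right; exists (free_part x) => //; split; first exact: free_part_sub.
        by apply/negP => ex; apply: nY; left.
      by left => -[//|Ex]; apply: nY; right; left.
    move=> [cx H] [nx|[Ex|[f fF Df]]]; last exact: cx fF Df.
      case: H => [nZE|[P [_ /negP nP] [_ [_ fx]]]]; first by apply: nZE; left;
        case: nx.
      by apply: nP; rewrite -fx; case: nx => _ [].
    case: H => [nZE|[P _ [Zx _]]]; first by apply: nZE; right.
    exact: ZE_disjoint Zx Ex.
  apply: openI; first exact: clear_open.
  apply: openU; first exact: closed_openC.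
  by apply: bigcup_open => P [PF _]; apply: with_free_part_open.
have -> : new_covered `|` new_boundary = (C `|` D) `|`
    [set y | exists2 f, f \in F & Y (act f^-1%g y)].
  apply/seteqP; split=> y.
    move=> [[Cy|[f fF nf]]|[Dy|[[f fF Ef]|[f fF [f' f'F Df]]]]].
    - by left; left.
    - by right; exists f => //; left.
    - by left; right.
    - by right; exists f => //; right; left.
    - by right; exists f => //; right; right; exists f'.
  move=> [[Cy|Dy]|[f fF [nf|[Ef|[f' f'F Df]]]]].
  - by left; left.
  - by right; left.
  - by left; right; exists f.
  - by right; right; left; exists f.
  - by right; right; right; exists f => //; exists f'.
apply: closedU => //; apply: closed_exists_fset => f _.
exact: (closed_preimage (@act_cont _)).
Qed.

(** A point of [Z] is either a new centre, and then its whole [F]-orbit is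
    covered, or too much of its [F]-orbit was covered to allow a new tile. *)
Lemma step_covers x : Z x -> clear x -> a <= 1 ->
  a * #|` F|%:R <= #|` [fset f in F | `[< new_covered (act f x) >]]%fset|%:R.
Proof.
move=> Zx cx a1; have [ex|] := boolP (enough (free_part x)).
  have -> : [fset f in F | `[< new_covered (act f x) >]]%fset = F.
    apply/fsetP => f; rewrite !inE andb_idr // => fF; apply/asboolP; right.
    by exists f => //; rewrite (actK act1 actM); split.
  by rewrite ler_piMl.
rewrite /enough -ltNge => few.
apply: (@le_trans _ _ #|` (F `\` free_part x)%fset|%:R).
  rewrite cardfsDS ?free_part_sub // natrB ?fsubset_leq_card ?free_part_sub //.
  by lra.
rewrite ler_nat; apply: fsubset_leq_card; apply/fsubsetP => f.
rewrite !inE => /andP[nf fF]; rewrite fF /=; apply/asboolP; left.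
by move: nf; rewrite fF /= => /asboolPn/contrapT.
Qed.

(** Each new tile has at least [(1 - a) * #|F|] new points, and new tiles are
    disjoint. *)
Lemma mean_le_new_centres :
  meanG_le (fun x => (1 - a) * #|` F|%:R * indic new_centres x)
       (fun x => indic new_covered x - indic C x).
Proof.
pose Q f := [set y | new_centres (act f^-1%g y) /\ ~ C y].
apply: (mean_le_trans (g := fun x => \sum_(f <- F) indic (Q f) (act f x))).
  apply: mean_leW => x; have [Tx|nT] := pselect (new_centres x); last first.
    by rewrite (ind_out nT) mulr0; apply: sumr_ge0 => f _; apply: ind_ge0.
  rewrite (ind_in Tx) mulr1; apply: le_trans (Tx.2.2) _.
  rewrite card_fset_sum; apply: ler_sum => f _.
  apply: (@ind_le R X [set z | ~ C z] (Q f)) => nC.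
  by split=> //; rewrite (actK act1 actM).
apply: (mean_le_trans (g := fun x => \sum_(f <- F) indic (Q f) x)).
  apply: mean_le_sum => f _; apply: (mean_le_shift actM (M := 1)) => // x.
  exact: ind_bound.
apply: mean_leW => y.
apply: (@le_trans _ _ (indic (new_covered `\` C) y)).
  apply: (@sum_ind_le R X _ F _ Q y (fun _ => y)); first exact: fset_uniq.
    by move=> f fF [Tf nC]; split=> //; right; exists f.
  move=> f f' fF f'F [[Zf _] _] [[Zf' _] _].
  by apply: (Z_sep.2 _ _ _ _ fF f'F Zf Zf'); rewrite !(actVK act1 actM).
have [Cy|nC] := pselect (C y).
  have nD : ~ (new_covered `\` C) y by case.
  rewrite (ind_in Cy) (ind_out nD).
  have Ny : new_covered y by left.
  by rewrite (ind_in Ny) subrr.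
by rewrite (ind_out nC) subr0; apply: ind_le => -[].
Qed.

Lemma mean_le_new_boundary (t u : R) :
  meanG_le (indic D) (fun=> t) -> meanG_le (indic E) (fun=> u) ->
  meanG_le (indic new_boundary)
           (fun=> t + (#|` F|%:R * u + #|` F|%:R ^+ 2 * t)).
Proof.
move=> Dt Eu.
have shift (B : set X) (v : R) g : meanG_le (indic B) (fun=> v) ->
    meanG_le (fun x => indic B (act g x)) (fun=> v).
  move=> Bv; apply: mean_le_trans Bv; apply: (mean_le_shift actM (M :=
    1)) => // x.
  exact: ind_bound.
apply: (mean_le_trans (g := fun y => indic D y +
    (\sum_(f <- F) indic E (act f^-1%g y) +
     \sum_(f <- F) \sum_(f' <- F) indic D (act (f' * f^-1)%g y)))).
  apply: mean_leW => y; apply: le_trans (indU_le _ _ _ _) _; rewrite lerD2l.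
  apply: le_trans (indU_le _ _ _ _) _; apply: lerD.
    exact: (@ind_le_sum R X _ F _ (fun=> E) y (fun f => act f^-1%g y)).
  apply: (@le_trans _ _ (\sum_(f <- F)
      indic [set z | exists2 f', f' \in F & D (act f' z)] (act f^-1%g y))).
    exact: (@ind_le_sum R X _ F _
      (fun=> [set z | exists2 f', f' \in F & D (act f' z)]) y).
  apply: ler_sum => f _; under [leRHS]eq_bigr do rewrite actM.
  exact: (@ind_le_sum R X _ F _ (fun=> D)).
have sumE (c : R) : \sum_(f <- F) c = #|` F|%:R * c.
  by rewrite sumr_const_fset mulrC.
have DD : meanG_le
    (fun y => \sum_(f <- F) \sum_(f' <- F) indic D (act (f' * f^-1)%g y))
    (fun=> \sum_(f <- F) \sum_(f' <- F) t).
  by apply: mean_le_sum => f _; apply: mean_le_sum => f' _; apply: shift.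
have EE : meanG_le (fun y => \sum_(f <- F) indic E (act f^-1%g y))
    (fun=> \sum_(f <- F) u).
  by apply: mean_le_sum => f _; apply: shift.
apply: mean_le_trans (mean_le_add Dt (mean_le_add EE DD)) _.
by apply: mean_leW => y; rewrite !sumE expr2 mulrA.
Qed.

End GreedyStep.

(** * Quasi-tilings *)

Section QuasiTiling.
Variables (R : realType) (G : groupType) (X : metricType R).
Variable (act : G -> X -> X).
Hypothesis act1 : forall x, act 1%g x = x.
Hypothesis actM : forall g h x, act (g * h)%g x = act g (act h x).
Hypothesis act_cont : forall g, continuous (act g).
Implicit Types (K F L P : {fset G}) (e a c t : R).

Notation meanG_le := (mean_le act (predT : {pred G})).

(** The factor by which the mean of the boundary grows in [n] greedy steps. It
    depends only on [F] and [n], so that the initial boundaries can be chosen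
    small after the number of steps is known. *)
Definition growth F (n : nat) : R :=
  iter n (fun b => b + (#|` F|%:R + #|` F|%:R ^+ 2 * b)) 1.

Lemma growth_gt0 F n : 0 < growth F n.
Proof.
elim: n => [|n IH]; first exact: ltr01.
by rewrite /growth iterS -/(growth F n) ltr_pwDl // addr_ge0 // mulr_ge0
  ?exprn_ge0 // ltW.
Qed.

(** The greedy steps over the sets [Z k] for [k] in [r]. The new tiles are kept
    track of through the set [T] of their centres, whose full orbits [F v] are
    covered: unlike the trimmed tiles, these are translates of the very
    invariant set [F]. *)
Lemma greedy_tiling K F e a t (J : finType) (Z : J -> set X)
    (I : finType) (S : I -> {fset G}) (V : I -> set X) (D : set X) :
  a <= 1 ->
  (forall P, (P `<=` F)%fset -> (1 - a) * #|` F|%:R <= #|` P|%:R ->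
     folner K e P) ->
  (forall k, open (Z k)) -> (forall k, small_injective act F e (Z k)) ->
  (forall k k' x, Z k x -> Z k' x -> k = k') ->
  meanG_le (indic (~` [set x | exists k, Z k x])) (fun=> t) ->
  partial_castle act K e S V -> closed D -> closed (foot act V S `|` D) ->
  meanG_le (indic D) (fun=> t) ->
  forall r : seq J, exists (I' : finType) (S' : I' -> {fset G})
    (V' : I' -> set X) (D' T : set X),
  let C := foot act V S in let C' := foot act V' S' in
  [/\ partial_castle act K e S' V', closed D', closed (C' `|` D') &
      meanG_le (indic D') (fun=> growth F (size r) * t)] /\
  [/\ C `<=` C',
      forall k x, k \in r -> Z k x -> (forall f, f \in F -> ~ D' (act f x)) ->
        a * #|` F|%:R <= #|` [fset f in F | `[< C' (act f x) >]]%fset|%:R,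
      forall v f, T v -> f \in F -> C' (act f v),
      forall y, C' y -> C y \/ exists2 f, f \in F & T (act f^-1%g y) &
      meanG_le (fun x => (1 - a) * #|` F|%:R * indic T x)
           (fun x => indic C' x - indic C x)].
Proof.
move=> a1 trim oZ sZ dZ domE pc cD cCD domD; set E := ~` _ in domE.
have cE : closed E.
  apply: open_closedC.
  have -> : [set x | exists k, Z k x] = \bigcup_(k in setT) Z k.
    by apply/seteqP; split=> x /= [k]; [exists k|move=> _; exists k].
  exact: bigcup_open.
have cZE k : closed (Z k `|` E).
  rewrite -openC.
  have -> : ~` (Z k `|` E) = \bigcup_(k' in [set k' | k' != k]) Z k'.
    apply/seteqP; split=> x.
      move=> nx; have [[k' Zx]|nZ] := pselect (exists k', Z k' x).
        by exists k' => //=; apply: contra_notN nx => /eqP <-; left.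
      by case: nx; right.
    move=> [k' /= /eqP kk' Zx] [Zkx|[]]; last by exists k'.
    by apply: kk'; apply: dZ Zx Zkx.
  exact: bigcup_open.
have ZE k x : Z k x -> ~ E x by move=> Zx; apply; exists k.
elim=> [|k r [I1 [S1 [V1 [D1 [T1 [[pc1 cD1 cCD1 domD1] [CC1 cov1 T1C C1T
  domT1]]]]]]]].
  exists I, S, V, D, set0; split=> //; split=> //; first by rewrite mul1r.
  - by move=> y; left.
  - by apply: mean_leW => x; rewrite ind_out ?mulr0 ?subrr //; case.
set C1 := foot act V1 S1 in cCD1 CC1 cov1 T1C C1T domT1.
have NC := new_coveredE act1 actM F a (Z k) D1 (erefl C1).
pose T2 := new_centres act F a (Z k) C1 D1.
pose C2 := new_covered act F a (Z k) C1 D1.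
exists _, (new_S (F := F) (a := a) S1), (new_V act (F := F) (a :=
  a) (Z k) C1 D1 V1),
  (new_boundary act F E D1), (T1 `|` T2).
move=> C C'; have C'E : C' = C2 by rewrite /C2 NC.
have CC2 : C1 `<=` C2 by move=> y; left.
rewrite C'E; split; split.
- exact: (new_partial_castle act1 actM act_cont pc1 (erefl C1) cD1 cCD1 (oZ k)
    (sZ k) trim).
- exact: (new_boundary_closed act_cont cD1 cE).
- exact: (new_covered_boundary_closed act_cont pc1 (erefl C1) cD1 cCD1
    (oZ k) (cZE k) (@ZE k)).
- apply: mean_le_trans (mean_le_new_boundary actM F domD1 domE) _.
  apply: mean_leW => x /=.
  by rewrite -/(growth F (size r)); lra.
- by move=> y /CC1 /CC2.
- move=> k' x; rewrite inE => k'r Zx nD.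
  have nD1 : forall f, f \in F -> ~ D1 (act f x).
    by move=> f fF D1f; apply: (nD f fF); left.
  case/orP: k'r => [/eqP kk'|k'r]; first by rewrite kk' in Zx;
    apply: step_covers.
  apply: le_trans (cov1 k' x k'r Zx nD1) _; rewrite ler_nat.
  apply: fsubset_leq_card; apply/fsubsetP => f;
    rewrite !inE => /andP[-> /asboolP Cf].
  by apply/asboolP; apply: CC2.
- move=> v f [T1v|T2v] fF; first by apply: CC2; apply: T1C.
  by right; exists f => //; rewrite (actK act1 actM).
- move=> y [/C1T[|[f fF Tf]]|[f fF Tf]]; first by left.
    by right; exists f => //; left.
  by right; exists f => //; right.
- have D12 := mean_le_add domT1 (mean_le_new_centres act1 actM a C1 D1 (sZ k)).
  apply: mean_le_trans (mean_le_trans _ D12) _; apply: mean_leW => x.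
    rewrite -mulrDr ler_wpM2l ?indU_le // mulr_ge0 //; lra.
  by rewrite -/C2 -/C /=; lra.
Qed.

End QuasiTiling.

Section Tilable.
Variables (R : realType) (G : groupType) (X : metricType R).
Variable (act : G -> X -> X).
Hypothesis act1 : forall x, act 1%g x = x.
Hypothesis actM : forall g h x, act (g * h)%g x = act g (act h x).
Hypothesis act_cont : forall g, continuous (act g).
Hypothesis act_free : free_action act.
Hypothesis X_compact : compact [set: X].
Variable N : {pred G}.
Hypothesis AF : almost_finite_along act N.
Hypothesis FG : has_folner R (predT : {pred G}).
Implicit Types (K F L P : {fset G}) (e a c t : R).

Notation meanG_le := (mean_le act (predT : {pred G})).

(** The points at which the [L]-neighbourhood crosses the boundary of [C]. *)
Definition mixed L (C : set X) : set X :=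
  [set x | exists l l', [/\ l \in L, l' \in L, C (act l x) & ~ C (act l' x)]].

(** The bound [c] on the uncovered mean is the quantity that decreases from pass
    to pass. The next pass needs the covered set to be almost clopen, and
    almost invariant under the smaller set [F] that it will use. *)
Definition tilable K e c : Prop := forall L (eta : R), 0 < eta ->
  exists (I : finType) (S : I -> {fset G}) (V : I -> set X) (D : set X),
  let C := foot act V S in
  [/\ partial_castle act K e S V, closed D, closed (C `|` D),
      meanG_le (indic D) (fun=> eta) &
      meanG_le (indic (~` C)) (fun=> c) /\
      meanG_le (indic (mixed L C)) (fun=> eta)].

Lemma tilable_le K e c c' : c <= c' -> tilable K e c -> tilable K e c'.
Proof.
move=> cc H L eta eta0; have [I [S [V [D [pc cD cCD dD [dC dM]]]]]] :=
  H L eta eta0.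
exists I, S, V, D; split=> //; split=> //.
by apply: mean_le_trans dC _; apply: mean_leW.
Qed.

Lemma tilable1 K e : tilable K e 1.
Proof.
move=> L eta eta0; exists void, (of_void _), (of_void _), set0.
have e0 (A : set X) (c : R) :
    0 <= c -> (forall x, ~ A x) -> meanG_le (indic A) (fun=> c).
  by move=> c0 nA; apply: mean_leW => x; rewrite ind_out.
have nf : forall x, ~ foot act (of_void (set X)) (of_void {fset G}) x.
  by move=> x [[]].
move=> C; have C0 : C = set0 by apply/seteqP; split=> x // /nf.
split.
- by split; case.
- exact: closed0.
- by rewrite C0 setU0; exact: closed0.
- by apply: e0 (ltW eta0) _ => x [].
- split; first by apply: mean_leW => x; apply: ind_le1.
  by apply: e0 (ltW eta0) _ => x [l [l' [_ _ /nf]]].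
Qed.

Section Step.
Variables (F L : {fset G}) (a : R) (C C' D' E T : set X).
Hypothesis F0 : F != fset0.
Hypothesis a01 : 0 <= a <= 1.
Hypothesis CC' : C `<=` C'.
Hypothesis covers : forall x, ~ E x -> (forall f, f \in F -> ~ D' (act f x)) ->
  a * #|` F|%:R <= #|` [fset f in F | `[< C' (act f x) >]]%fset|%:R.
Hypothesis TC' : forall v f, T v -> f \in F -> C' (act f v).
Hypothesis C'T : forall y, C' y -> C y \/ exists2 f, f \in F & T (act f^-1%g y).

Let L1 := (1%g |` (L `|` F))%fset.

(** Outside an exceptional set, either the whole [F]-orbit of a point was
    already covered, or a fraction [a] of it is covered now: averaging over
    [F], the uncovered density shrinks by the factor [1 - a]. *)
Lemma uncovered_average x :
  \sum_(f <- F) indic (~` C') (act f x) <= #|` F|%:R *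
    ((1 - a) * indic (~` C) x +
     (indic E x + (indic (mixed L1 C) x + \sum_(f <- F) indic D' (act f x))))
       :> R.
Proof.
case/andP: a01 => a0 a1.
have q0 : 0 < #|` F|%:R :> R by rewrite ltr0n cardfs_gt0.
have s0 : 0 <= \sum_(f <- F) indic D' (act f x) :> R.
  by apply: sumr_ge0 => f _; apply: ind_ge0.
have u0 : 0 <= (1 - a) * indic (~` C) x by rewrite mulr_ge0 ?subr_ge0 ?ind_ge0.
have E0 := @ind_ge0 R X E x; have M0 := @ind_ge0 R X (mixed L1 C) x.
have le_q : \sum_(f <- F) indic (~` C') (act f x) <= #|` F|%:R :> R.
  rewrite -[leRHS]mul1r -sumr_const_fset; apply: ler_sum => f _; exact: ind_le1.
set bad := indic E x + _; set W := _ + bad.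
have of_bad : 1 <= bad -> \sum_(f <- F) indic (~` C') (act f x) <= #|` F|%:R *
  W.
  by move=> h; apply: le_trans le_q _; rewrite ler_pMr // /W; lra.
have [Ex|nE] := pselect (E x); first by apply: of_bad;
  rewrite /bad (ind_in Ex) lerDl addr_ge0.
have [Mx|nM] := pselect (mixed L1 C x).
  by apply: of_bad; rewrite /bad (ind_in Mx) addrCA lerDl addr_ge0.
have [[f fF Df]|nD] := pselect (exists2 f, f \in F & D' (act f x)).
  apply: of_bad; rewrite /bad; have : 1 <= \sum_(f <- F) indic D' (act f x) :>
    R; last by lra.
  rewrite -(ind_in (R := R) Df) (big_rem f) //= lerDl.
  by apply: sumr_ge0 => f' _; apply: ind_ge0.
apply: (@le_trans _ _ (#|` F|%:R * ((1 - a) * indic (~` C) x))); last first.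
  by rewrite ler_wpM2l // /W lerDl !addr_ge0.
have [Cx|nC] := pselect (C x).
  rewrite ind_out; last by [].
  rewrite !mulr0 big_seq big1 // => f fF; rewrite ind_out //; apply.
  apply: CC'; apply: contrapT => nCf; apply: nM; exists 1%g, f.
  by split; rewrite ?act1 // !inE ?eqxx // fF !orbT.
have := covers nE (fun f fF Df => nD (ex_intro2 _ _ f fF Df)).
rewrite card_fset_sum (ind_in (A := ~` C)) // mulr1 => h.
under eq_bigr do rewrite indC.
rewrite sumrB sumr_const_fset mul1r; move: h; rewrite /indic; lra.
Qed.

(** A translate [L x] that newly straddles the boundary meets a new tile
    [F v] without being contained in it, so that [v] is a boundary translate
    of [x]; there are few of those because [F] is almost [L L^-1]-invariant. *)
Lemma mixed_le x : indic (mixed L C') x <= indic (mixed L1 C) x +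
  \sum_(l <- L) \sum_(l' <- L) \sum_(f <- exit (l' * l^-1)%g F)
    indic T (act (f^-1 * l)%g x) :> R.
Proof.
set s := \sum_(l <- L) _.
have s0 : 0 <= s by do 3!(apply: sumr_ge0 => ? _); apply: ind_ge0.
have [Mx|nM] := pselect (mixed L1 C x).
  by rewrite (ind_in Mx); apply: le_trans (ind_le1 _ _) _; rewrite lerDl.
rewrite (ind_out nM) add0r.
have [Mx|nM'] := pselect (mixed L C' x); last by rewrite (ind_out nM').
have [l [l' [lL l'L C'l nC'l]]] := Mx; rewrite (ind_in Mx).
have L1L k : k \in L -> k \in L1 by move=> kL; rewrite !inE kL orbT.
have nCl : ~ C (act l x).
  move=> Cl; apply: nM; exists l, l'; split; rewrite ?L1L //.
  by move=> /CC'.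
have [//|[f fF Tf]] := C'T C'l.
have fE : f \in exit (l' * l^-1)%g F.
  rewrite !inE fF /=; apply/negP => kF; apply: nC'l.
  have := TC' Tf kF; rewrite !actM (actVK act1 actM) (actK act1 actM) //.
rewrite /s (big_rem l) //= -[leLHS]addr0 lerD //; last first.
  by do 3!(apply: sumr_ge0 => ? _); apply: ind_ge0.
rewrite (big_rem l') //= -[leLHS]addr0 lerD //; last first.
  by do 2!(apply: sumr_ge0 => ? _); apply: ind_ge0.
rewrite (big_rem f) //= -[leLHS]addr0 lerD //; last first.
  by apply: sumr_ge0 => ? _; apply: ind_ge0.
by rewrite ind_in // actM.
Qed.

End Step.

(** A pass with a set [F] that is almost invariant under [L L^-1]. The previous
    castle is taken almost [F]-invariant, with an error [t] that is small in
    terms of the number of sets [Z k], which is known once [F] is. *)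
Lemma tilable_step K e c a : 0 < e -> 0 < c ->
  0 < a -> a <= 2^-1 -> a <= e / 4 ->
  tilable K e c -> tilable K e ((1 - a / 2) * c).
Proof.
move=> e0 c0 a0 a2 ae til L eta eta0.
have a1 : a < 1 by lra.
pose LL := [fset (l' * l^-1)%g | l' in L, l in L]%fset.
pose m : R := 4 * (#|` L|%:R ^+ 2 + 1).
have L2 : 0 <= #|` L|%:R ^+ 2 :> R by rewrite exprn_ge0.
have m0 : 0 < m by rewrite /m; lra.
(* The first bound keeps trimmed tiles invariant, and the second pays for the
   [#|L| ^ 2] pairs in [mixed_le]. *)
pose d := Num.min (e / 4) (eta / m).
have d0 : 0 < d by rewrite lt_min !divr_gt0.
have [de dm] : d <= e / 4 /\ d <= eta / m by rewrite /d !ge_min !lexx orbT.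
have [F _ FF] := FG (K := (K `|` LL)%fset) (fun _ _ => isT) d0.
have F0 := FF.1; have q0 := card_gt0_folner FF.
have trim P : (P `<=` F)%fset -> (1 - a) * #|` F|%:R <= #|` P|%:R ->
    folner K e P.
  move=> PF Pa; apply: (folner_trim (K := K) (d := d) _ PF a1 (ltW e0) Pa).
    by apply: folner_weaken FF => // k kK; rewrite inE kK.
  have : e * 2^-1 <= e * (1 - a) by apply: ler_wpM2l; [exact: ltW|lra].
  by move: de ae; lra.
have [J [U [oU cU sU]]] := small_injective_cover act1 actM act_cont act_free
  X_compact F e0.
pose b := growth R F (size (enum J)).
have b0 : 0 < b by apply: growth_gt0.
(* The errors of this pass are the final boundary, of mean [b * t], its [#|F|]
   translates, the sets [E] and the mixed points of the given castle. *)
pose M := b + 2 + #|` F|%:R * b.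
have Fb : 0 <= #|` F|%:R * b by rewrite mulr_ge0 // ltW.
have M0 : 0 < M by rewrite /M; lra.
pose t := Num.min eta (a * c) / (2 * M).
have t0 : 0 < t by rewrite divr_gt0 ?mulr_gt0 // lt_min eta0 mulr_gt0.
have [teta tac] : M * t <= eta / 2 /\ M * t <= a * c / 2.
  have -> : M * t = Num.min eta (a * c) / 2 by rewrite /t; field;
    rewrite gt_eqF.
  by rewrite !ler_pM2r ?invr_gt0 // !ge_min !lexx orbT.
have bt : b * t <= M * t by rewrite ler_pM2r // /M; lra.
have tM : t <= M * t by rewrite ler_peMl ?(ltW t0) // /M; lra.
have [Z [oZ ZU dZ domE]] := disjoint_refinement act1 actM act_cont X_compact AF
  oU cU t0.
have sZ k := small_injectiveS (ZU k) (sU k).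
have [I [S [V [D [pc cD cCD domD [domC domM]]]]]] :=
  til (1%g |` (L `|` F))%fset t t0.
have [I' [S' [V' [D' [T [[pc' cD' cCD' domD']
  [CC' covers TC' C'T domT]]]]]]] :=
  greedy_tiling act1 actM act_cont (ltW a1) trim oZ sZ dZ domE pc cD cCD domD
    (enum J).
set E := ~` _ in domE.
exists I', S', V', D' => C'.
have cov x : ~ E x -> (forall f, f \in F -> ~ D' (act f x)) ->
    a * #|` F|%:R <= #|` [fset f in F | `[< C' (act f x) >]]%fset|%:R.
  by move=> /contrapT[k Zx]; apply: covers Zx; rewrite mem_enum.
have shift (B : set X) (v : R) g : meanG_le (indic B) (fun=> v) ->
    meanG_le (fun x => indic B (act g x)) (fun=> v).
  move=> Bv; apply: mean_le_trans Bv; apply: (mean_le_shift actM (M :=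
    1)) => // x.
  exact: ind_bound.
have sumE (k : R) (A : {fset G}) : \sum_(f <- A) k = #|` A|%:R * k.
  by rewrite sumr_const_fset mulrC.
split=> //.
  apply: mean_le_trans domD' _; apply: mean_leW => x.
  by apply: le_trans bt _; lra.
split.
  have a01 : 0 <= a <= 1 by rewrite !ltW.
  have av := @mean_le_average R G X act act1 actM predT F 1 (indic (~` C'))
    (fun _ _ => isT) (ind_bound _).
  have dW : meanG_le (fun x => #|` F|%:R * ((1 - a) * indic (~` foot act V S)
    x +
     (indic E x + (indic (mixed (1%g |` (L `|` F))%fset (foot act V S)) x +
       \sum_(f <- F) indic D' (act f x)))))
     (fun=> #|` F|%:R * ((1 - a) * c + (t + (t + #|` F|%:R * (b * t))))).
    apply: mean_le_scale; first exact: ltW.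
    apply: mean_le_add; first by apply: mean_le_scale => //; lra.
    apply: mean_le_add domE _; apply: mean_le_add domM _.
    apply: (mean_le_trans (g := fun=> \sum_(f <- F) (b * t))).
      by apply: mean_le_sum => f _; apply: shift.
    by apply: mean_leW => x; rewrite sumE.
  have qV : 0 <= #|` F|%:R^-1 :> R by rewrite invr_ge0 ltW.
  have dall := mean_le_scale qV (mean_le_trans (mean_le_trans av (mean_leW _ _
    (uncovered_average L F0 a01 CC' cov))) dW).
  apply: mean_le_trans (mean_le_trans _ dall) _; apply: mean_leW => x.
    by rewrite mulKf ?gt_eqF.
  rewrite mulKf ?gt_eqF //.
  have : t + (t + #|` F|%:R * (b * t)) <= M * t.
    by rewrite /M mulrA; move: (mulr_ge0 (ltW b0) (ltW t0)); lra.
  move: tac; lra.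
have exit_card l l' : l \in L -> l' \in L ->
    #|` exit (l' * l^-1)%g F|%:R <= d * #|` F|%:R :> R.
  move=> lL l'L; apply: FF.2; rewrite inE; apply/orP; right.
  by apply/imfset2P; exists l' => //; exists l.
have dTl : meanG_le (fun x => \sum_(l <- L) \sum_(l' <- L)
     \sum_(f <- exit (l' * l^-1)%g F) indic T (act (f^-1 * l)%g x))
    (fun=> eta / 2).
  apply: (mean_le_trans (g := fun x => \sum_(l <- L) \sum_(l' <- L)
     \sum_(f <- exit (l' * l^-1)%g F) indic T x)).
    do 3!(apply: mean_le_sum => ? _).
    apply: (mean_le_shift actM (M := 1)) => // x; exact: ind_bound.
  apply: (mean_le_trans (g := fun x => #|` L|%:R ^+ 2 * (2 * d) *
      ((1 - a) * #|` F|%:R * indic T x))).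
    apply: mean_leW => x.
    apply: (@le_trans _ _ (\sum_(l <- L) \sum_(l' <- L)
        (d * #|` F|%:R * indic T x))).
      rewrite big_seq [leRHS]big_seq; apply: ler_sum => l lL.
      rewrite big_seq [leRHS]big_seq; apply: ler_sum => l' l'L.
      rewrite sumE; apply: ler_wpM2r; first exact: ind_ge0.
      exact: exit_card.
    rewrite !sumE mulrA -expr2 -[leRHS]mulrA; apply: ler_wpM2l => //.
    rewrite -!mulrA ; set y := #|` F|%:R * _.
    have y0 : 0 <= y by rewrite mulr_ge0 ?ind_ge0.
    rewrite [leRHS]mulrCA; apply: ler_wpM2l; first exact: ltW.
    by rewrite mulrA ler_peMl //; lra.
  apply: mean_le_trans (mean_le_scale _ domT) _;
    first by rewrite mulr_ge0 // mulr_ge0 // ltW.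
  apply: mean_leW => x.
  apply: (@le_trans _ _ (#|` L|%:R ^+ 2 * (2 * d))).
    apply: ler_piMr; first by rewrite mulr_ge0 // mulr_ge0 // ltW.
    have := ind_le1 (R := R) C' x; have := ind_ge0 (R := R) (foot act V S) x.
    by rewrite -/C'; lra.
  apply: (@le_trans _ _ (#|` L|%:R ^+ 2 * (2 * (eta / m)))).
    by rewrite ler_wpM2l // ler_wpM2l.
  rewrite mulrA mulrA ler_pdivrMr // /m; nra.
apply: mean_le_trans (mean_le_trans (mean_leW _ _ (mixed_le L CC' TC' C'T))
  (mean_le_add domM dTl)) _.
by apply: mean_leW => x; move: tM teta; lra.
Qed.

(** By Bernoulli's inequality the powers of [1 - a / 2] tend to [0]. *)
Lemma tilable_all K e c : 0 < e -> 0 < c -> tilable K e c.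
Proof.
move=> e0 c0; pose a := Num.min 2^-1 (e / 4).
have a0 : 0 < a by rewrite /a lt_min invr_gt0 ltr0n /= divr_gt0.
have [a2 ae] : a <= 2^-1 /\ a <= e / 4 by rewrite /a !ge_min !lexx orbT.
have r0 : 0 < 1 - a / 2 by lra.
have til n : tilable K e ((1 - a / 2) ^+ n).
  elim: n => [|n IH]; first by rewrite expr0; exact: tilable1.
  by rewrite exprS; apply: tilable_step => //; rewrite exprn_gt0.
have bern n : (1 - a / 2) ^+ n * (1 + n%:R * (a / 2)) <= 1.
  elim: n => [|n IH]; first by rewrite expr0 mul0r addr0 mulr1.
  apply: le_trans IH; rewrite exprSr -mulrA; apply: ler_wpM2l.
    by rewrite exprn_ge0 // ltW.
  have : 0 <= (n%:R + 1) * (a / 2) ^+ 2 by rewrite mulr_ge0 ?exprn_ge0 //; lra.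
  rewrite -natr1; nra.
have [n Hn] : exists n : nat, c^-1 <= n%:R * (a / 2).
  exists (Num.bound (c^-1 / (a / 2))); rewrite -ler_pdivrMr; last by lra.
  by apply/ltW/archi_boundP; rewrite divr_ge0 ?invr_ge0 ?ltW //; lra.
apply: tilable_le (til n).
have cn : c^-1 <= 1 + n%:R * (a / 2) by lra.
have := le_trans (ler_wpM2l (exprn_ge0 n (ltW r0)) cn) (bern n).
by rewrite ler_pdivrMr // mul1r.
Qed.

End Tilable.

(** * Almost finiteness of the ambient group *)

Section Diameter.
Variables (R : realType) (X : metricType R).

Lemma mdist_lt_diam (A : set X) (e : R) x y :
  (diam A < e%:E)%E -> A x -> A y -> mdist x y < e.
Proof.
rewrite /diam gt_max => /andP[_ supA] Ax Ay; rewrite -lte_fin.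
by apply: le_lt_trans supA; apply: ereal_sup_ubound; exists (x, y).
Qed.

Lemma diam_lt (A : set X) (d e : R) : 0 <= d -> d < e ->
  (forall x y, A x -> A y -> mdist x y <= d) -> (diam A < e%:E)%E.
Proof.
move=> d0 de Ad; apply: (@le_lt_trans _ _ d%:E); last by rewrite lte_fin.
rewrite /diam ge_max lee_fin d0; apply: ge_ereal_sup => _ [[x y] [Ax Ay] <-].
by rewrite lee_fin; apply: Ad.
Qed.

End Diameter.

Section Subgroup.
Variables (R : realType) (G : groupType) (X : metricType R).
Variable (act : G -> X -> X).
Hypothesis act1 : forall x, act 1%g x = x.
Hypothesis actM : forall g h x, act (g * h)%g x = act g (act h x).
Hypothesis act_cont : forall g, continuous (act g).
Hypothesis X_compact : compact [set: X].
Variables (N : {pred G}) (H : subGroupType N).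

Lemma val_in (x : H) : val x \in N. Proof. exact: valP. Qed.

Lemma in_val (x : G) : x \in N -> exists y : H, val y = x.
Proof. by move=> xN; exists (Sub x xN); rewrite SubK. Qed.

Lemma normal_subg_of : normal_subgroup N -> normal_subg N.
Proof.
move=> nN; split=> //.
- have <- : val (1%g : H) = 1%g by rewrite gmulf1.
  exact: val_in.
- by move=> _ _ /in_val[x <-] /in_val[y <-]; rewrite -gmulfM val_in.
- by move=> _ /in_val[x <-]; rewrite -gmulfV val_in.
Qed.

Lemma arbitrarily_large_of : infinite_set [set: H] -> arbitrarily_large N.
Proof.
move=> infH m; have [A _ mA] := infinite_set_fset m infH.
exists [fset val x | x in A]%fset; last by rewrite card_imfset_inj //;
  exact: val_inj.
by move=> _ /imfsetP[x _ ->]; apply: val_in.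
Qed.

Let img (S : {fset H}) : {fset G} := [fset val s | s in S]%fset.

Lemma folner_img (K : {fset G}) (d : R) (S : {fset H}) :
  {subset K <= N} ->
  folner [fset insubd 1%g k | k in K]%fset d S -> folner K d (img S).
Proof.
move=> KN [S0 FS]; split.
  have [s sS] := fset0Pn _ S0.
  by apply/fset0Pn; exists (val s); apply/imfsetP; exists s.
move=> k kK; rewrite card_imfset_inj; last exact: val_inj.
have kH : insubd 1%g k \in [fset insubd (1%g : H) k | k in K]%fset.
  by apply/imfsetP; exists k.
apply: le_trans (FS _ kH).
rewrite -(card_imfset_inj (exit (insubd 1%g k) S) (@val_inj _ _ H)) ler_nat.
apply: fsubset_leq_card; apply/fsubsetP => t; rewrite !inE => /andP[].
move=> /imfsetP[s /= sS ->] ks; apply/imfsetP; exists s => //=.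
rewrite !inE sS /=; apply: contra ks => ks; apply/imfsetP.
by exists (insubd 1%g k * s)%g => //=; rewrite gmulfM /= insubdK // KN.
Qed.

Lemma almost_finite_along_of :
  almost_finite (fun h : H => act (\val h)) -> almost_finite_along act N.
Proof.
move=> AF K d KN d0.
pose KH : {fset H} := [fset insubd 1%g k | k in K]%fset.
have KH0 : (1%g |` KH)%fset != fset0 by apply/fset0Pn; exists 1%g;
  rewrite !inE eqxx.
have [n [S [V [invS oV [dV smallV] [S' [S'S S'd sub]]]]]] := AF _ d KH0 d0.
set E := ~` _ in sub; set P := \bigcup_i _ in sub.
have disj : disjoint_towers act (fun i => img (S i)) V.
  move=> i j _ _ x y /imfsetP[s /= sS ->] /imfsetP[t /= tS ->] Vx Vy eqxy.
  have [-> ->] // : i = j /\ s = t.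
  have [-> ->] // : (i, s) = (j, t).
  apply: dV => //=.
  by exists (act (val s) x); split; [exists x|exists y].
have openC : open (\bigcup_i translates (fun h : H => act (\val h)) (S i) (V
  i)).
  have -> : \bigcup_i translates (fun h : H => act (\val h)) (S i) (V i) =
      foot act V (fun i => img (S i)).
    apply/seteqP; split=> y.
      move=> [i _ [s sS [x Vx <-]]]; exists i, (val s); split.
        by apply/imfsetP; exists s.
      by rewrite (actK act1 actM).
    move=> [i [_ [/imfsetP[s /= sS ->] Vs]]]; exists i => //; exists s => //.
    by exists (act (val s)^-1%g y) => //; rewrite (actVK act1 actM).
  exact: open_foot.
have compE : compact E.
  by apply: subclosed_compact X_compact _ => //; apply: open_closedC.
have [m [W [g [oW EW dW WP]]]] := sub E compE (fun _ h => h).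
exists 'I_n, 'I_m, (fun i => img (S i)), (fun i => img (S' i)), V, W,
  (fun j => val (g j)).
split=> //.
- by move=> i _ /imfsetP[s _ ->]; apply: val_in.
- move=> i; apply: folner_img KN _.
  apply: folner_weaken (fset_invariant_folner (invS i)) => //.
  by move=> k kK; rewrite inE kK orbT.
- move=> i _ x y /imfsetP[s /= sS ->] Vx Vy.
  by apply: mdist_lt_diam (smallV i s sS) _ _; [exists x|exists y].
- move=> i _ /imfsetP[s /= sS ->]; apply/imfsetP; exists s => //=.
  exact: (fsubsetP (S'S i)).
- by move=> i; rewrite !card_imfset_inj ?ltW //; exact: val_inj.
- by move=> j; apply: val_in.
- move=> x; have [Ex|nE] := pselect (E x).
    by have [j _ Wj] := EW x Ex; right; exists j.
  have [i _ [s sS [y Vy <-]]] := contrapT nE; left; exists i, (val s); split.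
    by apply/imfsetP; exists s.
  by rewrite (actK act1 actM).
- move=> j x Wx.
  have [|i _ [s sS [y Vy eqy]]] := WP j (act (val (g j)) x); first by exists x.
  exists i, (val s); split; first by apply/imfsetP; exists s.
  by rewrite -eqy (actK act1 actM).
- move=> j j' x x' Wx Wx' eqx; apply: dW => //.
  by exists (act (val (g j)) x); split; [exists x|exists x'].
Qed.

End Subgroup.

Lemma amenable_has_folner (R : realType) (G : groupType) :
  amenable G R -> has_folner R (predT : {pred G}).
Proof.
move=> amG K d _ d0.
have K0 : (1%g |` K)%fset != fset0 by apply/fset0Pn; exists 1%g;
  rewrite !inE eqxx.
have [T invT] := amG _ d K0 d0; exists T => //.
apply: folner_weaken (fset_invariant_folner invT) => //.
by move=> k kK; rewrite inE kK orbT.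
Qed.

(** Rounding [e / 2 * #|S|] down loses less than [1 <= e / 4 * #|S|]. *)
Lemma fset_fraction (R : realType) (T : choiceType) (S : {fset T}) (e : R) :
  0 < e -> e <= 1 -> 4 <= e * #|` S|%:R ->
  exists S' : {fset T}, [/\ (S' `<=` S)%fset, #|` S'|%:R < e * #|` S|%:R &
    e / 4 * #|` S|%:R <= #|` S'|%:R].
Proof.
move=> e0 e1 eS; pose k := Num.truncn (e / 2 * #|` S|%:R).
have h0 : 0 <= e / 2 * #|` S|%:R by rewrite mulr_ge0 // divr_ge0 // ltW.
have := truncn_itv h0; rewrite -/k => /andP[kle klt].
have kS : (k <= #|` S|)%N.
  by rewrite -(ler_nat R); apply: le_trans kle _; rewrite ler_piMl //; lra.
exists [fset x in take k (enum_fset S)]%fset.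
have ck : #|` [fset x in take k (enum_fset S)]%fset| = k.
  by rewrite card_fseq undup_id ?take_uniq ?fset_uniq // size_takel.
split.
- by apply/fsubsetP => x; rewrite inE => /mem_take.
- by rewrite ck; move: kle eS; lra.
- by rewrite ck; move: klt eS; rewrite -(natr1 k); lra.
Qed.

(* H is the subgroup of G whose underlying subset is N. *)
Theorem theorem1 (R : realType) (G : groupType) (X : metricType R)
    (act : G -> X -> X) (N : {pred G}) (H : subGroupType N)
    (G_countable : countable [set: G])
    (G_amenable : amenable G R)
    (X_compact : compact [set: X])
    (act_homeo : homeo_action act)
    (act_free : free_action act)
    (H_normal : normal_subgroup N)
    (H_infinite : infinite_set [set: H])
    (H_almost_finite : almost_finite (fun h : H => act (\val h))) :
  almost_finite act.
Proof.
have [act1 actM homeo] := act_homeo.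
have act_cont g : continuous (act g) by have [f' []] := homeo g.
have nN := normal_subg_of H H_normal.
have LN := arbitrarily_large_of H_infinite.
have AF := almost_finite_along_of act1 actM act_cont X_compact H_almost_finite.
have FG := amenable_has_folner G_amenable.
move=> K eps K0 eps0.
pose d := Num.min 1 eps.
have d0 : 0 < d by rewrite lt_min ltr01.
have [d1 deps] : d <= 1 /\ d <= eps by rewrite /d !ge_min !lexx orbT.
have [K2 _ K2large] := LN (Num.bound (4 / d)).
pose K' := (K `|` K2)%fset.
have c0 : 0 < 2 * #|` K'|%:R + 2 :> R by rewrite ltr_wpDl.
(* The set [K2] makes the shapes large enough for [fset_fraction], and [e] is
   small enough for [folner_fset_invariant] and [folner_card]. *)
pose e := d / (2 * #|` K'|%:R + 2).
have e0 : 0 < e by rewrite divr_gt0.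
have eK' : 2 * #|` K'|%:R * e + 2 * e = d.
  by rewrite /e; field; rewrite gt_eqF.
have KK' : #|` K|%:R * e <= #|` K'|%:R * e.
  by rewrite ler_pM2r // ler_nat fsubset_leq_card // fsubsetUl.
have d16 : 0 < d / 16 by rewrite divr_gt0.
have [I [S [V [D [pc _ _ _ [domC _]]]]]] := tilable_all act1 actM act_cont
  act_free X_compact AF FG K' e0 d16 fset0 (@ltr01 R).
have S_large i : 4 <= d * #|` S i|%:R.
  have K2S : (#|` K2| <= #|` S i|)%N.
    apply: leq_trans (folner_card (pc_folner pc i) _); last first.
      by rewrite mulrC; lra.
    by rewrite fsubset_leq_card // fsubsetUr.
  rewrite mulrC -ler_pdivrMr //.
  apply: (@le_trans _ _ (Num.bound (4 / d))%:R).
    by apply/ltW/archi_boundP; rewrite divr_ge0 // ltW.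
  by rewrite ler_nat; apply: leq_trans K2large K2S.
have [S' HS'] := choice (fun i => fset_fraction d0 d1 (S_large i)).
have S'S i : {subset S' i <= S i} by apply/fsubsetP; have [] := HS' i.
have SV := pc_disjoint pc.
have SS i : {subset S i <= S i} by [].
have ST (U : I -> {fset G}) i : {subset U i <= (predT : {pred G})} by [].
have d4 : 0 <= d / 4 by rewrite divr_ge0 // ltW.
have nT := normal_predT G.
have part : mean_le act predT (fun x => d / 4 * indic (foot act V S) x)
    (indic (foot act V S')).
  apply: (mean_le_trans (g := fun x => d / 4 * indic (foot act V S) (act 1%g
    x))).
    by apply: mean_leW => x; rewrite act1.
  apply: mean_le_trans (mean_le_scale d4 (mean_le_foot_levels act1 actM SV SS
    nT (ST S) 1%g)) _.
  apply: (mean_le_trans (g := fun x => indic (foot act V S') (act 1%g x)));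
    last first.
    by apply: mean_leW => x; rewrite act1.
  apply: mean_le_trans (mean_le_levels_foot act1 actM SV S'S nT (ST S') 1%g).
  apply: mean_leW => x; rewrite mulr_sumr; apply: ler_sum => i _.
  by rewrite mulrA ler_wpM2r ?ind_ge0 //; have [] := HS' i.
have oV := pc_open pc.
(* The complement has mean at most [d / 16], the part at least [d / 4] times the
   mean of the castle: the difference exceeds [d / 8]. *)
have compare : dyn_subequiv act (~` foot act V S) (foot act V S').
  apply: (comparison act1 actM act_cont X_compact (N := N) (c := d / 8)) => //.
  - by apply: open_closedC; apply: open_foot.
  - exact: open_foot.
  - by rewrite divr_gt0.
  have d41 : 0 <= 1 + d / 4 by lra.
  have := mean_le_add (mean_le_scale d41 domC) part => D1.
  apply: mean_le_trans (mean_le_trans _ (mean_le_add D1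
    (mean_leW act predT (fun x : X => lexx (- (d / 4)))))) _.
    by apply: mean_leW => x; rewrite indC; lra.
  by apply: mean_leW => x; nra.
have footE (U : I -> {fset G}) : foot act V U =
    \bigcup_(i in [set: 'I_#|I|]) translates act (U (enum_val i)) (V (enum_val
      i)).
  apply/seteqP; split=> y.
    move=> [i [s [sU Vs]]]; exists (enum_rank i) => //; rewrite enum_rankK.
    by exists s => //; exists (act s^-1%g y) => //; rewrite (actVK act1 actM).
  move=> [i _ [s sU [x Vx <-]]]; exists (enum_val i), s; split=> //.
  by rewrite (actK act1 actM).
exists #|I|, (fun i => S (enum_val i)), (fun i => V (enum_val i)); split.
- move=> i; apply: (@folner_fset_invariant _ _ _ e) => //.
    by move: eK' KK' deps; lra.
  apply: folner_weaken (pc_folner pc _) => //.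
  by move=> k kK; rewrite inE kK.
- by move=> i; apply: oV.
- split.
    move=> [i s] [j t] /= sS tS [z [[x Vx <-] [y Vy eqyx]]].
    have [ij st] := SV _ _ _ _ _ _ sS tS Vx Vy (esym eqyx).
    by rewrite (enum_val_inj ij) st.
  move=> i s sS; apply: (diam_lt (d := e)) => [||_ _ [x Vx <-] [y Vy <-]].
  + exact: ltW.
  + have : 0 <= #|` K'|%:R * e by rewrite mulr_ge0 // ltW.
    by move: eK' deps; lra.
  + by apply: ltW; apply: (pc_small pc sS Vx Vy).
- exists (fun i => S' (enum_val i)); split.
  + by move=> i; have [] := HS' (enum_val i).
  + move=> i; have [_ S'd _] := HS' (enum_val i); apply: lt_le_trans S'd _.
    by rewrite ler_wpM2r.
  + by rewrite -!footE.
Qed.
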